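(* Let $k\ge 1$ be an integer, let $s=2k+1$ and $N\ge 1$. Let $M_0,M_1,\dots,M_{2k}$ be the moments of the probability measure $\mu_k$ on $\mathbb{R}$, and for a multi-index $\beta=(\beta_1,\dots,\beta_N)\in\mathbb{N}_0^N$ with $|\beta|\le 2k$ put $M_\beta=\prod_{j=1}^N M_{\beta_j}$. Let $\mathcal{P}_s^=$ denote the space of all probability measures $\nu$ on $\mathbb{R}^N$ for which $\int_{\mathbb{R}^N}v^\beta\,d\nu(v)=M_\beta$ for all $|\beta|=0,1,\dots,2k$ and $\int_{\mathbb{R}^N}v^\beta\,d\nu(v)=0$ for all $|\beta|=s$. Then the metric space $(\mathcal{P}_s^=,d_s)$ is not complete.
   Context: $\mu_k$ is the probability measure on $\mathbb{R}$ with density $$p_k(x)=\begin{cases}0,&|x|<2,\\ \dfrac{C_k}{x^{2+2k}\log|x|},&|x|\ge 2,\end{cases}\qquad C_k=\Bigl(2\int_2^\infty\frac{dx}{x^{2+2k}\log x}\Bigr)^{-1}.$$ Its moments of order up to $2k$ are $M_0=1$, $M_{2\ell}=2\int_2^\infty\frac{C_kx^{2\ell}}{x^{2+2k}\log x}\,dx$ and $M_{2\ell-1}=0$ for $\ell=1,\dots,k$. For a multi-index $\beta\in\mathbb{N}_0^N$, $|\beta|=\beta_1+\dots+\beta_N$ and $v^\beta=v_1^{\beta_1}\cdots v_N^{\beta_N}$; requiring a moment $\int v^\beta d\nu$ to have a given value includes the requirement that $v^\beta$ is $\nu$-integrable. Probability measures are Borel probability measures. With $\hat\mu(x)=\int_{\mathbb{R}^N}e^{-i\langle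 x,v\rangle}\,d\mu(v)$, the metric is $$d_s(\mu,\nu)=\sup_{x\in\mathbb{R}^N\setminus\{0\}}\frac{|\hat\mu(x)-\hat\nu(x)|}{|x|^s}$$ with $|x|$ the Euclidean norm; it is finite on $\mathcal{P}_s^=$. *)

(* Defs.v *)
From HB Require Import structures.
From mathcomp Require Import all_boot all_order all_algebra complex.
From mathcomp Require Import all_classical all_reals all_analysis.
From mathcomp Require Import measurable_realfun ring lra.

Set Implicit Arguments.
Unset Strict Implicit.
Unset Printing Implicit Defensive.

Import Order.TTheory GRing.Theory Num.Theory.
Import numFieldNormedType.Exports.

Local Open Scope classical_set_scope.
Local Open Scope ring_scope.

Section heavy_tail.
Context {R : realType} (k : nat).
Notation leb := (@lebesgue_measure R).

Definition heavy_const : R :=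
  (2 * \int[leb]_(x in `[2, +oo[) (x ^+ (2 + 2 * k) * ln x)^-1)^-1.

Definition heavy_pdf (x : R) : R :=
  if `|x| < 2 then 0 else heavy_const / (x ^+ (2 + 2 * k) * ln `|x|).

Definition heavy_prob (A : set R) : \bar R :=
  (\int[leb]_(x in A) (heavy_pdf x)%:E)%E.

Let g (x : R) : R := (x ^+ (2 + 2 * k) * ln `|x|)^-1.
Let h (x : R) : R := (x ^+ (2 + 2 * k) * ln x)^-1.

Let m_inv : measurable_fun [set: R] (@GRing.inv R).
Proof.
rewrite (_ : GRing.inv = fun x : R => if x == 0 then 0 else x^-1); last first.
  by apply/funext => x; case: eqP => // ->; rewrite invr0.
apply: measurable_fun_if => //.
  by apply: measurable_fun_eqr.
rewrite setTI; apply: open_continuous_measurable_fun.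
  rewrite (_ : _ @^-1` _ = ~` [set 0]).
    apply: closed_openC; apply: accessible_closed_set1.
    by apply: hausdorff_accessible; exact: Rhausdorff.
  by apply/seteqP; split => x /=; [move/negbT/eqP|move/eqP/negbTE].
by move=> x; rewrite inE /= => /negbT x0; exact: inv_continuous.
Qed.

Let m_g : measurable_fun [set: R] g.
Proof.
apply: (measurableT_comp m_inv); apply: measurable_funM => //=.
by apply: measurableT_comp => //=; exact: measurable_ln.
Qed.

Let m_h : measurable_fun [set: R] h.
Proof.
by apply: (measurableT_comp m_inv); exact: measurable_funM.
Qed.

Let even2 : ~~ odd (2 + 2 * k).
Proof. by rewrite oddD oddM. Qed.

Let ln2_gt0 : 0 < ln 2 :> R.
Proof. by apply: ln_gt0; lra. Qed.

Let g_ge0 x : 2 <= `|x| -> 0 <= g x.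
Proof.
move=> x2; rewrite invr_ge0 mulr_ge0//.
  by rewrite exprn_even_ge0.
by apply: ln_ge0; lra.
Qed.

Let hg x : 2 <= x -> g x = h x.
Proof. by move=> x2; rewrite /g ger0_norm//; lra. Qed.

Let h_ge0 x : 2 <= x -> 0 <= h x.
Proof. by move=> x2; rewrite -hg// g_ge0// ger0_norm//; lra. Qed.

Let h_le x : 2 <= x -> h x <= (ln 2)^-1 * x ^- 2.
Proof.
move=> x2; rewrite -invfM lef_pV2 ?posrE; last 2 first.
- by rewrite mulr_gt0 ?ln_gt0 ?exprn_gt0//; lra.
- by rewrite mulr_gt0 ?exprn_gt0//; lra.
rewrite mulrC ler_pM//.
- by rewrite exprn_ge0//; lra.
- exact: ltW.
- by rewrite ler_weXn2l//; lra.
- by rewrite ler_ln ?posrE//; lra.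
Qed.

Let int_inv2 : (\int[leb]_(x in `[2%R, +oo[) (x ^- 2)%:E = (2^-1)%:E)%E.
Proof.
have d (x : R) : 2 <= x -> is_derive x 1 (fun y : R => - y^-1 : R) (x ^- 2).
  move=> x2; have x0 : x != 0 by apply: lt0r_neq0; lra.
  have -> : x ^- 2 = - (- x ^- 2 *: 1) by rewrite scaleNr opprK [_ *: _]mulr1.
  apply: is_deriveN; apply: DeriveDef.
    exact: (@derivableV _ _ id).
  by rewrite (@deriveV _ _ id)// derive_id.
have c (x : R) : 2 <= x -> {for x, continuous (fun y : R => - y^-1 : R)}.
  move=> x2; have x0 : x != 0 by apply: lt0r_neq0; lra.
  by apply: (@continuousN _ R^o); exact: inv_continuous.
rewrite (@ge0_continuous_FTC2y _ _ (fun x => - x^-1) _ 0).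
- by rewrite sub0e -EFinN opprK.
- by move=> x x2; rewrite invr_ge0 exprn_ge0//; lra.
- apply: continuous_in_subspaceT => x; rewrite inE/= in_itv/= andbT => x2.
  have x0 : x ^+ 2 != 0 by rewrite expf_neq0// lt0r_neq0//; lra.
  by apply: (@continuousV _ R^o (fun x => x ^+ 2)) => //; exact: exprn_continuous.
- rewrite -oppr0; apply: cvgN.
  by apply/gtr0_cvgV0; [exact: nbhs_pinfty_gt|exact: cvg_id].
- by move=> x x2; have [] := d _ (ltW x2).
- by apply/cvg_at_right_filter; exact: c.
- move=> x; rewrite in_itv/= andbT => x2.
  by rewrite derive1E; have [_ ->] := d _ (ltW x2).
Qed.

Let I := (\int[leb]_(x in `[2%R, +oo[) (h x)%:E)%E.

Let I_lty : (I < +oo)%E.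
Proof.
apply: (@le_lt_trans _ _ ((ln 2)^-1%:E * (2^-1)%:E)%E); last by rewrite -EFinM ltry.
rewrite -int_inv2 -ge0_integralZl//=; last 3 first.
- apply/measurable_EFinP/measurable_funTS/(measurableT_comp m_inv).
  exact: measurable_funX.
- by move=> x; rewrite in_itv/= andbT => x2; rewrite lee_fin invr_ge0 exprn_ge0//; lra.
- by rewrite lee_fin invr_ge0 ltW.
apply: ge0_le_integral => //=.
- by move=> x; rewrite in_itv/= andbT => x2; rewrite lee_fin h_ge0.
- exact/measurable_EFinP/measurable_funTS.
- apply/measurable_EFinP/measurable_funTS/measurable_funM => //.
  by apply/(measurableT_comp m_inv)/measurable_funX.
- by move=> x; rewrite in_itv/= andbT => x2; rewrite -EFinM lee_fin h_le.
Qed.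

Let I_gt0 : (0 < I)%E.
Proof.
have h3 : 0 < h 3 by rewrite invr_gt0 mulr_gt0 ?exprn_gt0 ?ln_gt0//; lra.
apply: (@lt_le_trans _ _ (h 3 * (3 - 2))%:E).
  by rewrite lte_fin mulr_gt0//; lra.
apply: (@le_trans _ _ (\int[leb]_(x in `[2%R, 3%R]) (h x)%:E)%E); last first.
  apply: ge0_subset_integral => //=.
  - exact/measurable_EFinP/measurable_funTS.
  - by move=> x; rewrite in_itv/= andbT => x2; rewrite lee_fin h_ge0.
  - by move=> x /=; rewrite !in_itv/= andbT => /andP[].
rewrite (_ : _%:E = \int[leb]_(x in `[2%R, 3%R]) (cst (h 3)%:E) x)%E.
  apply: ge0_le_integral => //=.
  - by move=> x _; rewrite lee_fin ltW.
  - exact/measurable_EFinP/measurable_funTS.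
  - move=> x; rewrite in_itv/= => /andP[x2 x3]; rewrite lee_fin lef_pV2 ?posrE.
    - rewrite ler_pM//.
      - by rewrite exprn_ge0//; lra.
      - by rewrite ln_ge0//; lra.
      - by rewrite lerXn2r ?nnegrE//; lra.
      - by rewrite ler_ln ?posrE//; lra.
    - by rewrite mulr_gt0 ?exprn_gt0 ?ln_gt0//; lra.
    - by rewrite mulr_gt0 ?exprn_gt0 ?ln_gt0//; lra.
rewrite integral_cst//= lebesgue_measure_itv/= lte_fin ifT; last by lra.
by rewrite EFinM EFinB.
Qed.

Let IE : I = (fine I)%:E.
Proof. by rewrite fineK// ge0_fin_numE// ltW. Qed.

Let fI_gt0 : 0 < fine I.
Proof. by rewrite -lte_fin -IE. Qed.

Let CE : heavy_const = (2 * fine I)^-1.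
Proof. by []. Qed.

Let C_gt0 : 0 < heavy_const.
Proof. by rewrite CE invr_gt0 mulr_gt0. Qed.

Lemma heavy_pdf_ge0 x : 0 <= heavy_pdf x.
Proof.
rewrite /heavy_pdf; case: ltP => // x2.
by rewrite mulr_ge0 ?(ltW C_gt0)//; exact: g_ge0.
Qed.

Lemma measurable_heavy_pdf : measurable_fun [set: R] heavy_pdf.
Proof.
apply: measurable_fun_ifT => //; first exact: measurable_fun_ltr.
exact: measurable_funM.
Qed.

Let right_half :
  (\int[leb]_(x in `[2%R, +oo[) (heavy_pdf x)%:E = heavy_const%:E * I)%E.
Proof.
rewrite -ge0_integralZl//=; last 3 first.
- exact/measurable_EFinP/measurable_funTS.
- by move=> x; rewrite in_itv/= andbT => x2; rewrite lee_fin h_ge0.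
- by rewrite lee_fin ltW.
apply: eq_integral => x; rewrite inE/= in_itv/= andbT => x2.
by rewrite /heavy_pdf ger0_norm ?(ltNge x) ?x2//=; lra.
Qed.

Let pdfN x : heavy_pdf (- x) = heavy_pdf x.
Proof. by rewrite /heavy_pdf normrN exprNn -signr_odd (negbTE even2) mul1r. Qed.

Let left_half :
  (\int[leb]_(x in `]-oo, (- 2)%R]) (heavy_pdf x)%:E = heavy_const%:E * I)%E.
Proof.
rewrite -[RHS]right_half.
pose G x := heavy_const * h (- x).
rewrite (_ : (\int[leb]_(x in _) _)%E =
    (\int[leb]_(x in `]-oo, (- 2)%R]) (G x)%:E)%E); last first.
  apply: eq_integral => x; rewrite inE/= in_itv/= => x2.
  rewrite -pdfN /G /h /heavy_pdf ger0_norm; last lra.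
  by rewrite ifF//; apply/negbTE; rewrite -leNgt; lra.
rewrite ge0_integration_by_substitutionNy.
- apply: eq_integral => x; rewrite inE/= in_itv/= andbT => x2.
  rewrite /G opprK /h /heavy_pdf ger0_norm; last lra.
  by rewrite ifF//; apply/negbTE; rewrite -leNgt.
- apply: continuous_in_subspaceT => x; rewrite inE/= in_itv/= => x2.
  have lx : 0 < ln (- x) by apply: ln_gt0; lra.
  have nz : (- x) ^+ (2 + 2 * k) * ln (- x) != 0.
    by rewrite mulf_neq0 ?expf_neq0 ?gt_eqF//; lra.
  apply: (@continuousM _ R^o (fun=> heavy_const) (fun x => h (- x))).
    exact: cst_continuous.
  apply: (@continuousV _ R^o (fun x => (- x) ^+ (2 + 2 * k) * ln (- x))) => //.
  apply: (@continuousM _ R^o (fun x => (- x) ^+ (2 + 2 * k)) (fun x => ln (- x))).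
    apply: (@continuous_comp R^o R^o R^o (fun x => - x) (fun x => x ^+ (2 + 2 * k))).
      exact: opp_continuous.
    exact: exprn_continuous.
  apply: (@continuous_comp R^o R^o R^o (fun x => - x) (@ln R)); first exact: opp_continuous.
  by apply: continuous_ln; lra.
- move=> x; rewrite in_itv/= => x2.
  by rewrite mulr_ge0 ?h_ge0// ?(ltW C_gt0)//; lra.
Qed.

Let heavy0 : heavy_prob set0 = 0%E.
Proof. exact: integral_set0. Qed.

Let heavy_ge0 A : (0 <= heavy_prob A)%E.
Proof. by apply: integral_ge0 => x _; rewrite lee_fin heavy_pdf_ge0. Qed.

Let heavy_sigma_additive : semi_sigma_additive heavy_prob.
Proof.
move=> /= F mF tF mUF; rewrite /heavy_prob; apply: cvg_toP.
  apply: ereal_nondecreasing_is_cvgn => m n mn.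
  apply: lee_sum_nneg_natr => // i _ _; apply: integral_ge0 => /= x _.
  by rewrite lee_fin heavy_pdf_ge0.
rewrite ge0_integral_bigcup//=; last first.
  by move=> x _; rewrite lee_fin heavy_pdf_ge0.
by apply/measurable_EFinP/measurable_funTS; exact: measurable_heavy_pdf.
Qed.

HB.instance Definition _ := isMeasure.Build _ _ _
  heavy_prob heavy0 heavy_ge0 heavy_sigma_additive.

Let heavy_setT : heavy_prob [set: R] = 1%E.
Proof.
have m_pdf A : measurable_fun A (EFin \o heavy_pdf).
  by apply/measurable_EFinP/measurable_funTS; exact: measurable_heavy_pdf.
have p0 (x : R) : (0 <= (heavy_pdf x)%:E)%E by rewrite lee_fin heavy_pdf_ge0.
rewrite /heavy_prob -(setUv `]-oo, (- 2)%R]) ge0_integral_setU//=; last 3 first.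
- by rewrite setCitvl; exact: measurable_itv.
- exact: m_pdf.
- exact/disj_setPCl.
rewrite left_half setCitvl.
rewrite (@itv_bndbnd_setU _ R (BRight (- 2)) (BLeft 2) +oo%O); last 2 first.
- by rewrite bnd_simp; lra.
- by [].
rewrite ge0_integral_setU//=; last 2 first.
- exact: m_pdf.
- rewrite disj_set2E; apply/eqP; rewrite -subset0 => x/=.
  by rewrite !in_itv/= andbT => -[/andP[_ x2]]; rewrite leNgt x2.
rewrite right_half [X in (_ + (X + _))%E]integral0_eq ?add0e; last first.
  move=> x; rewrite /= in_itv/= => /andP[x1 x2].
  by rewrite /heavy_pdf ifT// ltr_norml x1 x2.
rewrite IE -!EFinM -EFinD CE; congr EFin; field.
by rewrite gt_eqF.
Qed.

HB.instance Definition _ :=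
  @Measure_isProbability.Build _ _ R heavy_prob heavy_setT.

End heavy_tail.

Definition moment {R : realType} (k j : nat) : R :=
  \int[heavy_prob k]_(x in [set: R]) (x ^+ j).

Section Rn.
Context {R : realType} (N : nat).

Definition borel_Rn := g_sigma_algebraType (@open 'rV[R]_N).

Definition dotp (x v : 'rV[R]_N) : R := \sum_(j < N) x 0 j * v 0 j.

(* The norm `|x| of the library on 'rV[R]_N is the sup norm. *)
Definition norm2 (x : 'rV[R]_N) : R := Num.sqrt (dotp x x).

Definition monomial (b : {ffun 'I_N -> nat}) (v : 'rV[R]_N) : R :=
  \prod_(j < N) v 0 j ^+ b j.

Definition degree (b : {ffun 'I_N -> nat}) : nat := (\sum_(j < N) b j)%N.

Definition has_moment (nu : probability borel_Rn R) (b : {ffun 'I_N -> nat})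
    (m : R) : Prop :=
  nu.-integrable [set: borel_Rn] (EFin \o monomial b) /\
  \int[nu]_(v in [set: borel_Rn]) monomial b v = m.

(* The integral of exp (- i <x, v>), real and imaginary parts separately. *)
Definition fourier (nu : probability borel_Rn R) (x : 'rV[R]_N) : R[i] :=
  Complex (\int[nu]_(v in [set: borel_Rn]) cos (dotp x v))
          (- \int[nu]_(v in [set: borel_Rn]) sin (dotp x v)).

Definition fourier_dist (s : nat) (mu nu : probability borel_Rn R) : \bar R :=
  ereal_sup [set (ComplexField.Normc.normc (fourier mu x - fourier nu x)
                  / norm2 x ^+ s)%:E | x in [set x : 'rV[R]_N | x != 0]].

Lemma fourier_distxx s mu : (fourier_dist s mu mu <= 0)%E.
Proof.
apply: ge_ereal_sup => _ [x _ <-].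
by rewrite subrr ComplexField.Normc.normc0 mul0r.
Qed.

Lemma fourier_distC s mu nu : fourier_dist s mu nu = fourier_dist s nu mu.
Proof.
congr ereal_sup; apply: eq_imagel => x _.
by rewrite -[in LHS]opprB normcN.
Qed.

Lemma fourier_dist_triangle s nu mu la :
  (fourier_dist s mu la <= fourier_dist s mu nu + fourier_dist s nu la)%E.
Proof.
apply: ge_ereal_sup => _ [x x0 <-].
pose r a b := ComplexField.Normc.normc (fourier a x - fourier b x) / norm2 x ^+ s.
apply: (@le_trans _ _ ((r mu nu)%:E + (r nu la)%:E)%E).
  rewrite -EFinD lee_fin -mulrDl ler_wpM2r ?invr_ge0 ?exprn_ge0 ?sqrtr_ge0//.
  by rewrite -(subrKA (fourier nu x)); exact: le_normcD.
by apply: leeD; apply: ereal_sup_ubound; exists x.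
Qed.

(* The product is the b-th moment of the N-fold product of heavy_prob k. *)
Definition prescribed_moments (k s : nat) (nu : probability borel_Rn R) : Prop :=
  (forall b, (degree b <= 2 * k)%N ->
     has_moment nu b (\prod_(j < N) moment k (b j))) /\
  (forall b, degree b = s -> has_moment nu b 0).

Definition P_eq (k s : nat) : Type :=
  {nu : probability borel_Rn R | prescribed_moments k s nu}.

Section P_eq_metric.
Variables k s : nat.
Local Notation P := (P_eq k s).

HB.instance Definition _ := gen_eqMixin P.
HB.instance Definition _ := gen_choiceMixin P.

Definition P_ball (mu : P) (e : R) (nu : P) : Prop :=
  (fourier_dist s (sval mu) (sval nu) < e%:E)%E.

Let P_nbhs (mu : P) : set_system P := nbhs_ (entourage_ P_ball) mu.

HB.instance Definition _ := hasNbhs.Build P P_nbhs.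

Let P_nbhsE : P_nbhs = nbhs_ (entourage_ P_ball). Proof. by []. Qed.

Let P_ball_center (mu : P) (e : R) : 0 < e -> P_ball mu e mu.
Proof. by move=> e0; apply: le_lt_trans (fourier_distxx _ _) _; rewrite lte_fin. Qed.

Let P_ball_sym (mu nu : P) (e : R) : P_ball mu e nu -> P_ball nu e mu.
Proof. by rewrite /P_ball fourier_distC. Qed.

Let P_ball_triangle (mu nu la : P) (e1 e2 : R) :
  P_ball mu e1 nu -> P_ball nu e2 la -> P_ball mu (e1 + e2) la.
Proof.
move=> d1 d2; apply: le_lt_trans (fourier_dist_triangle _ (sval nu) _ _) _.
by rewrite EFinD; exact: lteD.
Qed.

HB.instance Definition _ := @Nbhs_isPseudoMetric.Build R P
  (entourage_ P_ball) P_nbhsE P_ball P_ball_center P_ball_sym P_ball_triangle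
  erefl.

End P_eq_metric.
End Rn.
Arguments P_eq R N k s : clear implicits.

(* The completeness axiom of completeType, with cvg F spelled out because
   P_eq is not a pointed type. *)
Definition complete_space (T : uniformType) : Prop :=
  forall F : set_system T, ProperFilter F -> cauchy F -> exists l : T, F --> l.

(* Main.v *)
Require Import Defs.
From mathcomp Require Import all_boot all_order all_algebra.
From mathcomp Require Import all_classical all_reals all_analysis.
From HB Require Import structures.
From mathcomp Require Import complex measurable_realfun ring lra zify.

Set Implicit Arguments.
Unset Strict Implicit.
Unset Printing Implicit Defensive.

Import Order.TTheory GRing.Theory Num.Theory.
Import numFieldNormedType.Exports.

Local Open Scope classical_set_scope.
Local Open Scope ring_scope.

(** Let R_k(u) = (-1)^(k+1) (cos u - T_2k(u)), with T_2k the Taylor polynomial of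
    degree 2k; then 0 <= R_k(u) <= min(u^(2k), u^(2k+2)), so that the quotients
    R_k(2^m u) / |2^m u|^(2k+1) are summable over m with a sum bounded in u.

    The moments of mu_k lie in the interior of the set of moment sequences, so
    they are those of a finitely supported symmetric measure which can absorb
    small perturbations. Adding small masses proportional to 2^(-i(2k+1))/(i+1)
    at +-2^i for i < p, and correcting the moments of order <= 2k on the fixed
    support, yields measures whose absolute moment of order 2k+1 grows like the
    harmonic sum, while their differences, tested against R_k(t x)/|t|^(2k+1),
    are O(1/q) for p >= q by the dyadic bound. Taking them as first marginal of a
    product with a fixed finitely supported measure gives a Cauchy sequence.

    A limit nu has the same moments of order <= 2k and the limit Fourier
    transform, hence the limit of the integrals of R_k(t v_1). Summing
    2^(m(2k+1)) R_k(2^(-m) v_1) over m < n gives at most 4 |v_1|^(2k+1), but its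
    integral is at least a positive multiple of the harmonic sum up to an
    additive constant. So v_1^(2k+1) is not integrable, and nu is not in the space. *)

(** * Taylor remainders of the cosine *)

Section taylor_remainders.
Context {R : realType}.
Implicit Types (u : R) (k n : nat).

(* [cos_rem k u] is (-1)^(k+1) times the difference between [cos u] and its
   Taylor polynomial of degree 2k; similarly for [sin_rem] and degree 2k+1. *)
Fixpoint cos_rem k u : R :=
  if k is k'.+1 then u ^+ (2 * k) / (2 * k)`!%:R - cos_rem k' u else 1 - cos u.

Fixpoint sin_rem k u : R :=
  if k is k'.+1 then u ^+ (2 * k).+1 / (2 * k).+1`!%:R - sin_rem k' u
  else u - sin u.

Lemma is_derive_expn_fact n u :
  is_derive u 1 (fun x : R => x ^+ n.+1 / n.+1`!%:R) (u ^+ n / n`!%:R).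
Proof.
have -> : (fun x : R => x ^+ n.+1 / n.+1`!%:R) = (n.+1`!%:R^-1) \*: (id ^+ n.+1).
  by apply/funext => x /=; rewrite fctE mulrC.
apply: is_derive_eq (is_deriveZ _ (is_deriveX n.+1 (is_derive_id u 1))) _.
rewrite [LHS](_ : _ = n.+1`!%:R^-1 * (n.+1%:R * u ^+ n * 1))// mulr1 factS natrM invfM.
have n0 : n.+1%:R != 0 :> R by rewrite pnatr_eq0.
have f0 : n`!%:R != 0 :> R by rewrite pnatr_eq0 -lt0n fact_gt0.
by field; rewrite f0 nat1r.
Qed.

Lemma is_derive_cos_rem0 u : is_derive u 1 (cos_rem 0) (sin u).
Proof.
have -> : cos_rem 0 = cst 1 - @cos R by [].
by apply: is_derive_eq; rewrite sub0r opprK.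
Qed.

Lemma is_derive_cos_rem k u : is_derive u 1 (cos_rem k.+1) (sin_rem k u).
Proof.
elim: k u => [|k IH] u.
  have -> : cos_rem 1 = (fun x => x ^+ 2 / 2`!%:R) - cos_rem 0 by [].
  apply: is_deriveB; last exact: is_derive_cos_rem0.
  by apply: is_derive_eq (is_derive_expn_fact 1 u) _; rewrite divr1.
pose n := (2 * k.+1).+1.
have -> : cos_rem k.+2 = (fun x => x ^+ n.+1 / n.+1`!%:R) - cos_rem k.+1.
  by apply/funext => x; rewrite /n (_ : (2 * k.+1).+2 = 2 * k.+2)%N//; lia.
by apply: is_deriveB; exact: is_derive_expn_fact.
Qed.

Lemma is_derive_sin_rem k u : is_derive u 1 (sin_rem k) (cos_rem k u).
Proof.
elim: k u => [|k IH] u.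
  by have -> : sin_rem 0 = id - @sin R by []; exact: is_deriveB.
have -> : sin_rem k.+1 = (fun x => x ^+ (2 * k.+1).+1 / (2 * k.+1).+1`!%:R) - sin_rem k.
  by [].
by apply: is_deriveB; exact: is_derive_expn_fact.
Qed.

Lemma ge0_of_derive_ge0 (f f' : R -> R) :
  (forall x : R, is_derive x 1 f (f' x)) -> f 0 = 0 ->
  (forall x, 0 <= x -> 0 <= f' x) -> forall x, 0 <= x -> 0 <= f x.
Proof.
move=> df f0 f'0 x x0; rewrite -f0.
apply: (@ger0_derive1_ndecry _ f 0) => //.
- move=> y; rewrite in_itv/= andbT => y0; rewrite derive1E.
  by have [_ ->] := df y; rewrite f'0// ltW.
- apply: continuous_subspaceT => y; apply/differentiable_continuous.
  exact/derivable1_diffP.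
Qed.

Lemma cos_rem0 k : cos_rem k 0 = 0.
Proof.
elim: k => [|k IH]; first by rewrite /= cos0 subrr.
by rewrite /= -/cos_rem IH mulnS expr0n/= mul0r subrr.
Qed.

Lemma sin_rem0 k : sin_rem k 0 = 0.
Proof.
elim: k => [|k IH]; first by rewrite /= sin0 subrr.
by rewrite /= -/sin_rem IH expr0n/= mul0r subrr.
Qed.

Lemma cos_remN k u : cos_rem k (- u) = cos_rem k u.
Proof.
elim: k => [|k IH]; first by rewrite /= cosN.
by rewrite /= -/cos_rem IH exprNn -signr_odd oddM/= mul1r.
Qed.

(** By evenness only [u >= 0] matters. There every remainder vanishes at 0 and has the preceding
    one, in the alternating order cosine, sine, cosine, as its derivative, so nonnegativity
    propagates by a joint induction from [cos u <= 1]. *)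
Lemma cos_rem_ge0 k u : 0 <= cos_rem k u.
Proof.
wlog u0 : u / 0 <= u.
  by move=> H; case: (leP 0 u) => [|/ltW u0]; [exact: H|rewrite -cos_remN H ?oppr_ge0].
suff: forall x, 0 <= x -> 0 <= cos_rem k x /\ 0 <= sin_rem k x by move=> /(_ u u0)[].
elim: k {u u0} => [|k IH] x x0.
  have c0 (y : R) : 0 <= cos_rem 0 y by rewrite /= subr_ge0 cos_le1.
  split => //.
  apply: (ge0_of_derive_ge0 (is_derive_sin_rem 0)) x0; first exact: sin_rem0.
  by move=> y _; exact: c0.
have c0 y : 0 <= y -> 0 <= cos_rem k.+1 y.
  apply: (ge0_of_derive_ge0 (is_derive_cos_rem k)); first exact: cos_rem0.
  by move=> z /IH[].
split; first exact: c0.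
by apply: (ge0_of_derive_ge0 (is_derive_sin_rem k.+1)) x0; first exact: sin_rem0.
Qed.

Lemma cos_remS k u : cos_rem k.+1 u = u ^+ (2 * k.+1) / (2 * k.+1)`!%:R - cos_rem k u.
Proof. by []. Qed.

Lemma cos_rem_le k u : cos_rem k.+1 u <= u ^+ (2 * k.+1).
Proof.
rewrite cos_remS lerBlDr ler_wpDr ?cos_rem_ge0// ler_piMr//.
  by rewrite exprM exprn_ge0 ?sqr_ge0.
by rewrite invf_le1 ?ler1n ?ltr0n fact_gt0.
Qed.

(** The remainder of index [k.+1] is the Taylor term of order 2k+2 minus this one, and it is
    nonnegative. *)
Lemma cos_rem_le2 k u : cos_rem k u <= u ^+ (2 * k.+1).
Proof.
have := cos_rem_ge0 k.+1 u; rewrite cos_remS subr_ge0 => /le_trans; apply.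
rewrite ler_piMr//.
  by rewrite exprM exprn_ge0 ?sqr_ge0.
by rewrite invf_le1 ?ler1n ?ltr0n fact_gt0.
Qed.

(** Two steps of the recursion at 1, with the remainder of index [k.+2] nonnegative, leave at least
    1/(2k+2)! - 1/(2k+4)!. *)
Lemma cos_rem1_gt0 k : 0 < cos_rem k 1.
Proof.
have := cos_rem_ge0 k.+2 1; rewrite !cos_remS !expr1n !div1r.
set a := (2 * k.+1)`!; set b := (2 * k.+2)`!.
suff : b%:R^-1 < a%:R^-1 :> R by lra.
rewrite ltf_pV2 ?posrE ?ltr0n ?fact_gt0// ltr_nat /a /b.
by rewrite (_ : (2 * k.+2)%N = (2 * k.+1).+2) ?ltn_fact//; lia.
Qed.

(* Bounded when summed over dyadic scales, by [dyadic_sum_le]. *)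
Lemma cos_rem_le_min k u : 0 < u ->
  cos_rem k.+1 u <= u ^+ (2 * k.+1).+1 * Num.min u u^-1.
Proof.
move=> u0; rewrite -[leLHS]mulr1.
case: (leP u u^-1) => _.
  by rewrite mulr1 -exprSr (le_trans (cos_rem_le2 _ _))// (_ : (2 * k.+2 = (2 * k.+1).+2)%N)//; lia.
by rewrite mulr1 exprSr mulfK ?gt_eqF// cos_rem_le.
Qed.

Lemma cos_rem_le_odd k u : cos_rem k.+1 u <= `|u| ^+ (2 * k.+1).+1.
Proof.
have [u0|u0] := eqVneq u 0; first by rewrite u0 cos_rem0 normr0 expr0n.
have -> : cos_rem k.+1 u = cos_rem k.+1 `|u|.
  by case: (ger0P u); rewrite ?cos_remN.
apply: (le_trans (cos_rem_le_min _ _)); rewrite ?normr_gt0//.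
rewrite ler_piMr ?exprn_ge0// ge_min.
case: (leP `|u| 1) => //= u1.
by rewrite invf_le1 ?normr_gt0// ltW.
Qed.

End taylor_remainders.

Lemma dyadic_sum_le {R : realType} (u : R) n : 0 < u ->
  \sum_(i < n) Num.min (u * 2 ^+ i) (u * 2 ^+ i)^-1 <= 4.
Proof.
move=> u0.
(* The bound 4 alone does not pass from [u * 2] to [u]. The refined bounds do: [2 / u] from 1 on,
   where the sum is geometric, and [4 - u] below 1, where the slack pays for the new term [u]. *)
suff : (1 <= u -> \sum_(i < n) Num.min (u * 2 ^+ i) (u * 2 ^+ i)^-1 <= 2 / u) /\
       (u < 1 -> \sum_(i < n) Num.min (u * 2 ^+ i) (u * 2 ^+ i)^-1 <= 4 - u).
  move=> [H1 H2]; case: (leP 1 u) => [u1|/H2]; last lra.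
  apply: (le_trans (H1 u1)); rewrite ler_pdivrMr//; lra.
elim: n u u0 => [|n IH] u u0.
  by rewrite big_ord0; split=> u1; [rewrite divr_ge0// ltW|lra].
rewrite big_ord_recl expr0 mulr1.
under eq_bigr do rewrite lift0 exprS mulrA.
have [|IH1 IH2] := IH (u * 2); first lra.
have uV : u * u^-1 = 1 by rewrite mulfV ?gt_eqF.
have u2V : 2 / (u * 2) = u^-1 by rewrite invfM mulrC divfK.
split=> u1.
  have -> : 2 / u = u^-1 + u^-1 by rewrite mulrDl mul1r.
  apply: lerD; first by rewrite ge_min lexx orbT.
  by rewrite -u2V; apply: IH1; lra.
case: (leP 1 (u * 2)) => u21.
  apply: (@le_trans _ _ (u + u^-1)).
    by apply: lerD; [rewrite ge_min lexx|rewrite -u2V; exact: IH1].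
  nra.
apply: (@le_trans _ _ (u + (4 - u * 2))); last lra.
by apply: lerD; [rewrite ge_min lexx|exact: IH2].
Qed.

(** * Moments of the heavy-tailed measure *)

Section density.
Context d (T : measurableType d) {R : realType}.
Variables (mu nu : {measure set T -> \bar R}) (p : T -> R).
Hypotheses (mp : measurable_fun [set: T] p) (p0 : forall x, 0 <= p x).
Hypothesis nuE : forall A, measurable A -> nu A = (\int[mu]_(x in A) (p x)%:E)%E.

Import HBNNSimple.

Let mpE D : measurable_fun D (EFin \o p).
Proof. exact/measurable_EFinP/measurable_funTS. Qed.

Let integral_density_nnsfun (f : {nnsfun T >-> R}) :
  (\int[nu]_x (f x)%:E = \int[mu]_x ((f x)%:E * (p x)%:E))%E.
Proof.
under [LHS]eq_integral do rewrite fimfunE -fsumEFin//.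
rewrite [LHS]ge0_integral_fsum//; last 2 first.
- by move=> r; exact/measurable_EFinP/measurableT_comp.
- by move=> n x _; rewrite EFinM nnfun_muleindic_ge0.
under [RHS]eq_integral.
  move=> x _; rewrite fimfunE -fsumEFin// muleC ge0_mule_fsumr; last first.
    by move=> r; rewrite EFinM nnfun_muleindic_ge0.
  over.
rewrite [RHS]ge0_integral_fsum//; last 2 first.
- move=> r; apply: emeasurable_funM; first exact: mpE.
  by apply/measurable_EFinP/measurable_funM.
- move=> n x _; apply: mule_ge0; first by rewrite lee_fin.
  by rewrite EFinM nnfun_muleindic_ge0.
apply: eq_fsbigr => r /[!inE] -[x _ <-]; rewrite integralZl_indic_nnsfun//.
rewrite integral_indic//= setIT nuE//.
under [RHS]eq_integral do rewrite EFinM muleCA.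
rewrite ge0_integralZl//; first last.
- by rewrite lee_fin.
- by move=> y _; rewrite mule_ge0 ?lee_fin.
- by apply: emeasurable_funM; [exact: mpE|exact/measurable_EFinP/measurable_indic].
congr (_ * _)%E; rewrite integral_mkcond; apply: eq_integral => y _.
rewrite patchE indicE; case: ifPn => yA; first by rewrite mule1.
by rewrite mule0.
Qed.

(** Both sides agree on nonnegative simple functions; monotone convergence along simple
    approximations of [f] does the rest. *)
Lemma ge0_integral_density (f : T -> \bar R) :
  measurable_fun [set: T] f -> (forall x, 0 <= f x)%E ->
  (\int[nu]_x f x = \int[mu]_x (f x * (p x)%:E))%E.
Proof.
move=> mf f0; pose f_ := nnsfun_approx measurableT mf.
have nd (x : T) m n : (m <= n)%N -> f_ m x <= f_ n x.
  by move=> mn; exact/lefP/nd_nnsfun_approx.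
transitivity (lim (\int[nu]_x (f_ n x)%:E @[n --> \oo])%E).
  rewrite -monotone_convergence//=.
  - apply: eq_integral => x _; apply/esym/cvg_lim => //.
    exact: cvg_nnsfun_approx.
  - by move=> n; exact/measurable_EFinP/measurable_funTS.
  - by move=> n x _; rewrite lee_fin.
  - by move=> x _ m n mn; rewrite lee_fin nd.
rewrite [RHS](_ : _ = lim (\int[mu]_x ((f_ n x)%:E * (p x)%:E) @[n --> \oo])%E).
  by apply: congr_lim; apply/funext => n /=; exact: integral_density_nnsfun.
rewrite -monotone_convergence//=.
- apply: eq_integral => x _; apply/esym/cvg_lim => //.
  by apply: cvgeZr => //; exact: cvg_nnsfun_approx.
- by move=> n; apply: emeasurable_funM; [exact/measurable_EFinP/measurable_funTS|exact: mpE].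
- by move=> n x _; rewrite mule_ge0 ?lee_fin.
- by move=> x _ m n mn; rewrite lee_pmul ?lee_fin// nd.
Qed.

End density.

Section heavy_prob_properties.
Context {R : realType} (k : nat).
Notation leb := (@lebesgue_measure R).
Notation mu := (@heavy_prob R k).

Lemma heavy_pdf_even (x : R) : heavy_pdf k (- x) = heavy_pdf k x.
Proof. by rewrite /heavy_pdf normrN exprNn -signr_odd oddD oddM/= mul1r. Qed.

(* [heavy_prob k] is a measure on [R] with its default measurable structure,
   whereas [lebesgue_measure] lives on [measurableTypeR R]. *)
Definition to_R (x : measurableTypeR R) : R := x.

Lemma measurable_to_R : measurable_fun [set: measurableTypeR R] to_R.
Proof. by move=> _ A mA; rewrite setTI. Qed.

Definition leb_R : {measure set R -> \bar R} :=
  measure_function_pushforward__canonical__measure_function_Measure leb measurable_to_R.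

Lemma ge0_integral_leb_R D (f : R -> \bar R) :
  measurable D -> measurable_fun D f -> (forall x, 0 <= f x)%E ->
  (\int[leb_R]_(x in D) f x = \int[leb]_(x in D) f x)%E.
Proof.
by move=> mD mf f0; rewrite (ge0_integral_pushforward measurable_to_R).
Qed.

Lemma ge0_integral_heavy_prob (f : R -> \bar R) :
  measurable_fun [set: R] f -> (forall x, 0 <= f x)%E ->
  (\int[mu]_x f x = \int[leb]_x (f x * (heavy_pdf k x)%:E))%E.
Proof.
have mp D : measurable_fun D (EFin \o @heavy_pdf R k).
  by apply/measurable_EFinP/measurable_funTS; exact: measurable_heavy_pdf.
have p0 (x : R) : (0 <= (heavy_pdf k x)%:E)%E by rewrite lee_fin heavy_pdf_ge0.
move=> mf f0; rewrite -ge0_integral_leb_R//; last 2 first.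
- exact: emeasurable_funM.
- by move=> x; exact: mule_ge0.
apply: ge0_integral_density => //.
- exact: measurable_heavy_pdf.
- by move=> A mA; rewrite ge0_integral_leb_R.
Qed.

Lemma heavy_prob0 (A : set R) : measurable A -> leb A = 0%E -> mu A = 0%E.
Proof.
move=> mA A0; apply: null_set_integral => //.
by apply/measurable_EFinP/measurable_funTS; exact: measurable_heavy_pdf.
Qed.

(** The density is even and Lebesgue measure is invariant under reflection. *)
Lemma heavy_probN (A : set R) : measurable A ->
  pushforward mu (-%R : R -> R) A = mu A.
Proof.
move=> mA; rewrite /pushforward /heavy_prob.
rewrite [RHS](_ : _ = \int[pushforward leb (-%R : measurableTypeR R -> measurableTypeR R)]_(x in A)
   (heavy_pdf k x)%:E)%E; last first.
  by apply: eq_measure_integral => B mB _; rewrite [RHS]lebesgue_measureN.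
rewrite ge0_integral_pushforward//.
- by apply: eq_integral => x _; rewrite /= heavy_pdf_even.
- by apply/measurable_EFinP/measurable_funTS; exact: measurable_heavy_pdf.
- by move=> x _; rewrite lee_fin heavy_pdf_ge0.
Qed.

End heavy_prob_properties.

Lemma heavy_const_neq0 (R : realType) k : @heavy_const R k != 0.
Proof.
apply/negP => /eqP c0.
have : (@heavy_prob R k setT != 0)%E by rewrite probability_setT.
move/eqP; apply; apply: integral0_eq => x _.
by rewrite /heavy_pdf c0 mul0r if_same.
Qed.

(** On the support |x| >= 2, |x|^j is at most x^(2k), and x^(2k) times the density is a constant
    multiple of the density of index 0, whose total mass is 1. *)
Lemma integrable_heavy_prob (R : realType) k j : (j <= 2 * k)%N ->
  (@heavy_prob R k).-integrable setT (EFin \o (fun x => x ^+ j)).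
Proof.
move=> jk; apply/integrableP; split.
  by apply/measurable_EFinP; exact: measurable_funX.
have mj : measurable_fun [set: R] (fun x : R => `|(x ^+ j)%:E|)%E.
  by do 2 apply: measurableT_comp => //; apply/measurable_EFinP; exact: measurable_funX.
rewrite ge0_integral_heavy_prob//=.
pose c : R := heavy_const k / heavy_const 0.
apply: (@le_lt_trans _ _ (\int[lebesgue_measure]_x (`|c| * heavy_pdf 0 x)%:E)%E).
  apply: ge0_le_integral => //=.
  - by move=> x _; rewrite mule_ge0 ?lee_fin// heavy_pdf_ge0.
  - apply: emeasurable_funM.
      exact: mj.
    by apply/measurable_EFinP; exact: measurable_heavy_pdf.
  - by apply/measurable_EFinP; apply: measurable_funM => //; exact: measurable_heavy_pdf.
  move=> x _; rewrite lee_fin /heavy_pdf; case: ltP => x2; first by rewrite !mulr0.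
  have x0 : x != 0 by rewrite -normr_gt0; lra.
  have lx : 0 < ln `|x| by apply: ln_gt0; lra.
  have xE m : x ^+ (2 + 2 * m) = `|x| ^+ (2 + 2 * m).
    by rewrite -normrX ger0_norm// exprn_even_ge0// oddD oddM.
  rewrite !xE muln0 addn0.
  apply: (@le_trans _ _ (`|x| ^+ (2 * k) * (`|heavy_const k| / (`|x| ^+ (2 + 2 * k) * ln `|x|)))).
    apply: ler_pM => //.
    - have := heavy_pdf_ge0 k x; rewrite /heavy_pdf ltNge x2/= xE//.
    - by rewrite normrX ler_weXn2l//; lra.
    - by rewrite ler_wpM2r ?ler_norm// invr_ge0 mulr_ge0 ?exprn_ge0// ltW.
  have c0 : `|heavy_const 0| != 0 :> R by rewrite normr_eq0 heavy_const_neq0.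
  have c00 : 0 <= heavy_const 0 :> R.
    have := heavy_pdf_ge0 0 (2 : R); rewrite /heavy_pdf normr_nat ltxx pmulr_lge0//.
    by rewrite invr_gt0 mulr_gt0// ln_gt0//; lra.
  rewrite /c normrM (normfV (heavy_const 0)) (ger0_norm c00) le_eqVlt; apply/orP; left; apply/eqP.
  rewrite exprD; field.
  by rewrite heavy_const_neq0 ?normr_eq0 ?x0 gt_eqF// expf_neq0 ?normr_eq0.
under eq_integral do rewrite EFinM.
rewrite ge0_integralZl ?lee_fin//; first last.
- by move=> x _; rewrite lee_fin heavy_pdf_ge0.
- by apply/measurable_EFinP; exact: measurable_heavy_pdf.
have -> : (\int[lebesgue_measure]_x (heavy_pdf 0 x)%:E = 1 :> \bar R)%E.
  exact: probability_setT (@heavy_prob R 0).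
by rewrite mule1 ltry.
Qed.

(** Reflection invariance makes the moment equal to its opposite. *)
Lemma moment_odd (R : realType) k j : odd j -> (j <= 2 * k)%N -> @moment R k j = 0.
Proof.
move=> oj jk; suff : @moment R k j = - moment k j by lra.
have ij := @integrable_heavy_prob R k j jk.
have ijN : (@heavy_prob R k).-integrable setT
    ((EFin \o (fun x => x ^+ j)) \o (-%R : R -> R)).
  apply/(eq_integrable measurableT _ _ _ (integrableN ij)) => x _ /=.
  by rewrite exprNn -signr_odd oj expr1 mulN1r.
rewrite /moment /Rintegral.
rewrite [in LHS](_ : (\int[_]_(x in _) _)%E = (\int[pushforward (heavy_prob k)
   (-%R : R -> R)]_x (x ^+ j)%:E)%E); last first.
  by apply: eq_measure_integral => B mB _; rewrite [RHS]heavy_probN.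
rewrite (@integral_pushforward _ _ _ _ _ (-%R : R -> R))//; last first.
  by apply/measurable_EFinP; exact: measurable_funX.
rewrite -fineN -integralN//=; last exact: integrable_add_def.
congr fine; apply: eq_integral => x _ /=.
by rewrite exprNn -signr_odd oj expr1 mulN1r EFinN.
Qed.

Lemma moment0 (R : realType) k : @moment R k 0 = 1.
Proof.
rewrite /moment; under eq_Rintegral do rewrite expr0.
rewrite Rintegral_cst// mul1r -[RHS]/(fine 1%E); congr fine.
exact: probability_setT.
Qed.

(** * Finitely supported measures with prescribed even moments *)

Lemma Rintegral_sum d (T : measurableType d) (R : realType)
    (mu : {measure set T -> \bar R}) (I : Type) (s : seq I) (f : I -> T -> R) :
  (forall i, mu.-integrable setT (EFin \o f i)) ->
  \int[mu]_x (\sum_(i <- s) f i x) = \sum_(i <- s) \int[mu]_x f i x.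
Proof.
move=> intf; rewrite /Rintegral.
under eq_integral do rewrite -sumEFin.
rewrite (integral_sum measurableT (f := fun i x => (f i x)%:E))// sum_fine// => i _.
exact: (integrable_fin_num measurableT (intf i)).
Qed.

Lemma integrable_Rsum d (T : measurableType d) (R : realType)
    (mu : {measure set T -> \bar R}) (I : Type) (s : seq I) (f : I -> T -> R) :
  (forall i, mu.-integrable setT (EFin \o f i)) ->
  mu.-integrable setT (EFin \o (fun x => \sum_(i <- s) f i x)).
Proof.
move=> intf; have := integrable_sum measurableT s (P := xpredT) (fun i _ => intf i).
by apply: (eq_integrable measurableT) => // x _ /=; rewrite sumEFin.
Qed.

(** * Convergence of determinants and inverse matrices *)

Section matrix_limits.
Context {R : realType}.

Lemma cvg_sumr (I : Type) (s : seq I) (f : nat -> I -> R) (l : I -> R) :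
  (forall i, f n i @[n --> \oo] --> l i) ->
  \sum_(i <- s) f n i @[n --> \oo] --> \sum_(i <- s) l i.
Proof.
move=> fl; elim: s => [|i s IH].
  by under eq_fun do rewrite big_nil; rewrite big_nil; exact: cvg_cst.
under eq_fun do rewrite big_cons; rewrite big_cons; exact: cvgD.
Qed.

Lemma cvg_prodr (I : Type) (s : seq I) (f : nat -> I -> R) (l : I -> R) :
  (forall i, f n i @[n --> \oo] --> l i) ->
  \prod_(i <- s) f n i @[n --> \oo] --> \prod_(i <- s) l i.
Proof.
move=> fl; elim: s => [|i s IH].
  by under eq_fun do rewrite big_nil; rewrite big_nil; exact: cvg_cst.
under eq_fun do rewrite big_cons; rewrite big_cons; exact: cvgM.
Qed.

Lemma cvg_det m (A : nat -> 'M[R]_m) (L : 'M[R]_m) :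
  (forall i j, A n i j @[n --> \oo] --> L i j) ->
  \det (A n) @[n --> \oo] --> \det L.
Proof.
move=> AL; apply: cvg_sumr => s; apply: cvgM; first exact: cvg_cst.
by apply: cvg_prodr => i; exact: AL.
Qed.

(** The determinant and the cofactors converge by the Leibniz formula; the determinant is then
    eventually nonzero, and the adjugate formula gives the inverse. *)
Lemma cvg_invmx m (A : nat -> 'M[R]_m) (L : 'M[R]_m) : L \in unitmx ->
  (forall i j, A n i j @[n --> \oo] --> L i j) ->
  (\forall n \near \oo, A n \in unitmx) /\
  (forall i j, invmx (A n) i j @[n --> \oo] --> invmx L i j).
Proof.
move=> uL AL; have dL := cvg_det AL.
have L0 : \det L != 0 by rewrite -unitfE -unitmxE.
have uA : \forall n \near \oo, A n \in unitmx.
  near=> n; rewrite unitmxE unitfE -normr_gt0.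
  near: n; apply: (cvgr_gt _ (cvg_norm dL)).
  by rewrite normr_gt0.
split => // i j.
have -> : invmx L i j = (\det L)^-1 * \adj L i j by rewrite /invmx uL !mxE.
have : (\det (A n))^-1 * \adj (A n) i j @[n --> \oo] --> (\det L)^-1 * \adj L i j.
  apply: cvgM; first exact: cvgV.
  under eq_fun do rewrite mxE; rewrite mxE.
  apply: cvgM; first exact: cvg_cst.
  apply: cvg_det => i' j'; under eq_fun do rewrite !mxE; rewrite !mxE; exact: AL.
apply: cvg_trans; apply: near_eq_cvg; near=> n.
by rewrite /invmx ifT ?mxE//; near: n.
Unshelve. all: by end_near. Qed.

End matrix_limits.

Lemma even_pow_le {R : realType} (y : R) a b : (a <= b)%N ->
  y ^+ (2 * a) <= 1 + y ^+ (2 * b).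
Proof.
move=> ab; rewrite !exprM; have := sqr_ge0 y; set z := y ^+ 2 => z0.
case: (leP 1 z) => z1.
  by apply: ler_wpDl => //; rewrite ler_weXn2l.
apply: (@le_trans _ _ 1); first by rewrite exprn_ile1// ltW.
by rewrite lerDl exprn_ge0.
Qed.

Lemma normr_even_pow {R : realDomainType} (x : R) j : `|x| ^+ (2 * j) = x ^+ (2 * j).
Proof. by rewrite !exprM real_normK// num_real. Qed.

(** * Approximation of even moments by finitely supported measures *)

Section discretization.
Import HBNNSimple.
Context {R : realType}.
Variables (mu : probability R R) (k : nat).
Hypothesis mu_int : mu.-integrable setT (EFin \o (fun x : R => x ^+ (2 * k))).

(** The growth bound supplies the integrable majorant for dominated convergence. *)
Definition subpoly (f : R -> R) := continuous f /\ forall y, `|f y| <= 1 + y ^+ (2 * k).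

Let mnorm : measurable_fun [set: R] (EFin \o (@Num.norm R R)).
Proof. by apply/measurable_EFinP; exact: normr_measurable. Qed.

(** The absolute value is approximated rather than the identity: [nnsfun_approx] increases to
    nonnegative functions, and even moments depend on |x| only. *)
Definition simple_norm n : {nnsfun R >-> R} := nnsfun_approx measurableT mnorm n.

Let cvg_simple_norm x : simple_norm n x @[n --> \oo] --> `|x|.
Proof.
apply: (fine_cvg (f := fun n => (simple_norm n x)%:E)).
by apply: (cvg_nnsfun_approx measurableT mnorm) => // y _; rewrite lee_fin.
Qed.

Let simple_norm_le n x : simple_norm n x <= `|x|.
Proof.
rewrite -lee_fin /simple_norm nnsfun_approxE.
by apply: (le_approx (f := EFin \o (@Num.norm R R))) => // y _; rewrite lee_fin.
Qed.

Let dom_int : mu.-integrable setT (EFin \o (fun x : R => 1 + x ^+ (2 * k))).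
Proof.
have := integrableD measurableT (finite_measure_integrable_cst mu 1 measurableT) mu_int.
by apply: (eq_integrable measurableT) => // x _.
Qed.

Let dom_le (f : R -> R) (x y : R) : subpoly f -> 0 <= y -> y <= `|x| ->
  `|f y| <= 1 + x ^+ (2 * k).
Proof.
move=> [_ fle] y0 yx; apply: (le_trans (fle y)).
by rewrite lerD2l -[leRHS]normr_even_pow lerXn2r ?nnegrE.
Qed.

Lemma integrable_subpoly (f : R -> R) : subpoly f ->
  mu.-integrable setT (EFin \o (fun x => f `|x|)).
Proof.
move=> sf; apply: le_integrable dom_int => //.
  apply/measurable_EFinP; apply: (measurableT_comp (f := f)) => //.
  by apply: continuous_measurable_fun; exact: sf.1.
move=> x _ /=; rewrite lee_fin (le_trans (dom_le (x := x) sf _ _))//.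
exact: ler_norm.
Qed.

Lemma cvg_simple_integral (f : R -> R) : subpoly f ->
  \int[mu]_x f (simple_norm n x) @[n --> \oo] --> \int[mu]_x f `|x|.
Proof.
move=> sf; have mf : measurable_fun setT f.
  by apply: continuous_measurable_fun; exact: sf.1.
apply: fine_cvg.
rewrite fineK; last by apply: integrable_fin_num => //; exact: integrable_subpoly.
have [] // := @dominated_convergence _ _ _ mu setT measurableT
  (fun n x => (f (simple_norm n x))%:E) (fun x => (f `|x|)%:E)
  (EFin \o (fun x : R => 1 + x ^+ (2 * k))).
- move=> n; apply/measurable_EFinP; exact: (measurableT_comp (f := f)).
- by apply/measurable_EFinP; exact: (measurableT_comp (f := f)).
- apply: aeW => x _; apply: cvg_EFin; first exact: nearW.
  apply: continuous_cvg; first exact: sf.1.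
  exact: cvg_simple_norm.
- by apply: aeW => x n _; rewrite lee_fin (dom_le sf).
Qed.

(** Together with [simple_mass], this describes the finitely supported law of [simple_norm n] under
    [mu]. *)
Definition simple_atoms n : seq R := finmap.enum_fset (fset_set (range (simple_norm n))).
Definition simple_mass n (y : R) : R := fine (mu (simple_norm n @^-1` [set y])).

Lemma simple_integral n (f : R -> R) :
  \int[mu]_x f (simple_norm n x) = \sum_(y <- simple_atoms n) simple_mass n y * f y.
Proof.
have fin : finite_set (range (simple_norm n)) by exact: fimfunP.
transitivity (\int[mu]_x (\sum_(y <- simple_atoms n) f y * \1_(simple_norm n @^-1` [set y]) x)).
  apply: eq_Rintegral => x _.
  rewrite (bigD1_seq (simple_norm n x))/= ?finmap.fset_uniq//; last first.
    by rewrite /simple_atoms in_fset_set// inE; exists x.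
  rewrite indicE mem_set// mulr1 big1 ?addr0// => y yx.
  by rewrite indicE memNset ?mulr0//= => xy; rewrite xy eqxx in yx.
have ii y : mu.-integrable setT (EFin \o (\1_(simple_norm n @^-1` [set y]) : R -> R)).
  by apply: integrable_indic => //; rewrite probability_setT ltry.
rewrite Rintegral_sum; last first.
  move=> y; have := integrableZl measurableT (f y) (ii y).
  by apply: (eq_integrable measurableT) => // x _.
apply: eq_bigr => y _; rewrite RintegralZl// mulrC; congr (_ * _).
by rewrite /Rintegral integral_indic// setIT.
Qed.

End discretization.

(** * Gram matrix of the even powers and exact correction of moments *)

Section gram.
Context {R : realType}.
Variables (mu : probability R R) (k : nat).
Hypothesis mu_int : mu.-integrable setT (EFin \o (fun x : R => x ^+ (2 * k))).
Hypothesis mu_fin : forall A : set R, finite_set A -> measurable A -> mu A = 0%E.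
Import HBNNSimple.

(* Bounded weights, so that [1 + \sum_j a j * weight j] is positive for small [a]. *)
Definition weight (j : 'I_k.+1) (y : R) : R := y ^+ (2 * j) / (1 + y ^+ (2 * (2 * k))).

Let weight_den_gt0 (y : R) : 0 < 1 + y ^+ (2 * (2 * k)).
Proof. by rewrite ltr_pwDl// exprM exprn_ge0 ?sqr_ge0. Qed.

Lemma even_pow_ge0 (y : R) j : 0 <= y ^+ (2 * j).
Proof. by rewrite exprM exprn_ge0 ?sqr_ge0. Qed.

Lemma weight_bound j y : `|weight j y| <= 1.
Proof.
rewrite /weight ger0_norm; last by rewrite divr_ge0 ?even_pow_ge0// ltW.
rewrite ler_pdivrMr// mul1r even_pow_le//.
by have := ltn_ord j; lia.
Qed.

Lemma subpoly_pow (l : 'I_k.+1) : subpoly k (fun y : R => y ^+ (2 * l)).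
Proof.
split; first exact: exprn_continuous.
by move=> y; rewrite ger0_norm ?even_pow_ge0// even_pow_le// -ltnS.
Qed.

Lemma subpoly_gram (j l : 'I_k.+1) : subpoly k (fun y : R => weight j y * y ^+ (2 * l)).
Proof.
split.
  move=> y; rewrite /weight; apply: cvgM; last exact: exprn_continuous.
  apply: cvgM; first exact: exprn_continuous.
  apply: cvgV; first by rewrite gt_eqF.
  apply: cvgD; first exact: cvg_cst.
  exact: exprn_continuous.
move=> y; rewrite /weight mulrAC -exprD -mulnDr ger0_norm; last first.
  by rewrite divr_ge0 ?even_pow_ge0// ltW.
apply: (@le_trans _ _ 1); last by rewrite lerDl even_pow_ge0.
rewrite ler_pdivrMr// mul1r even_pow_le//.
by have := ltn_ord j; have := ltn_ord l; lia.
Qed.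

(** Gram matrix of 1, x^2, ..., x^(2k) in L^2 of [mu] weighted by 1/(1 + x^(4k)); the weight makes
    the products integrable although moments of [mu] are assumed only up to order 2k. *)
Definition gram : 'M[R]_k.+1 := \matrix_(j, l) \int[mu]_x (weight j `|x| * `|x| ^+ (2 * l)).

Lemma finite_roots (q : {poly R}) : q != 0 -> finite_set [set x | root q x].
Proof.
move=> q0; apply: contrapT => /(infinite_set_fset (size q)) [B Bq].
apply/negP; rewrite -ltnNge; apply: max_poly_roots => //; last exact: finmap.fset_uniq.
by apply/allP => x xB; apply: (Bq x).
Qed.

Let quad (v : 'rV[R]_k.+1) (x : R) :=
  \sum_(l < k.+1) v 0 l * \sum_(j < k.+1) v 0 j * (weight j `|x| * `|x| ^+ (2 * l)).

Let quadE v x : quad v x =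
  (\sum_(l < k.+1) v 0 l * x ^+ (2 * l)) ^+ 2 / (1 + x ^+ (2 * (2 * k))).
Proof.
rewrite expr2 [in RHS]mulr_suml mulr_suml; apply: eq_bigr => l _.
rewrite -!mulrA; congr (_ * _); rewrite mulrA mulr_sumr mulr_suml.
by apply: eq_bigr => j _; rewrite /weight !normr_even_pow; ring.
Qed.

Let int_entry (j l : 'I_k.+1) (c : R) : mu.-integrable setT
  (EFin \o (fun x => c * (weight j `|x| * `|x| ^+ (2 * l)))).
Proof.
have := integrableZl measurableT c (integrable_subpoly mu_int (subpoly_gram j l)).
by apply: (eq_integrable measurableT).
Qed.

Let quad_int v : mu.-integrable setT (EFin \o quad v).
Proof.
apply: integrable_Rsum => l.
have /(integrableZl measurableT (v 0 l)) :=
  integrable_Rsum (index_enum _) (fun j => int_entry j l (v 0 j)).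
by apply: (eq_integrable measurableT).
Qed.

Let Rintegral_quad v : \int[mu]_x quad v x = \sum_(l < k.+1) v 0 l * (v *m gram) 0 l.
Proof.
rewrite Rintegral_sum; last first.
  move=> l; have /(integrableZl measurableT (v 0 l)) :=
    integrable_Rsum (index_enum _) (fun j => int_entry j l (v 0 j)).
  by apply: (eq_integrable measurableT).
apply: eq_bigr => l _; rewrite RintegralZl//; last first.
  exact: (integrable_Rsum (index_enum _) (fun j => int_entry j l (v 0 j))).
congr (_ * _); rewrite Rintegral_sum//.
rewrite mxE; apply: eq_bigr => j _; rewrite mxE RintegralZl//.
exact: (integrable_subpoly mu_int (subpoly_gram j l)).
Qed.

(** A kernel vector yields an even polynomial [q] such that q^2/(1 + x^(4k)) has integral 0. Then
    [q] vanishes almost everywhere, whereas the roots of a nonzero polynomial form a finite set,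
    which is null. *)
Lemma gram_unit : gram \in unitmx.
Proof.
rewrite -row_free_unit; apply: inj_row_free => v vG; apply/eqP/negPn/negP => v0.
pose q : {poly R} := \sum_(l < k.+1) v 0 l *: 'X^(2 * l).
have q0 : q != 0.
  apply: contra_neq v0 => q0; apply/rowP => l; rewrite mxE.
  have := congr1 (fun p : {poly R} => p`_(2 * l)) q0; rewrite coef0 coef_sum.
  rewrite (bigD1 l)//= coefZ coefXn eqxx mulr1 big1 ?addr0// => j jl.
  rewrite coefZ coefXn eqn_mul2l/= [(l : nat) == j]eq_sym.
  by rewrite (inj_eq val_inj) (negbTE jl) mulr0.
have qE x : q.[x] = \sum_(l < k.+1) v 0 l * x ^+ (2 * l).
  by rewrite horner_sum; apply: eq_bigr => l _; rewrite hornerZ hornerXn.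
have quad_ge0 x : 0 <= quad v x.
  by rewrite quadE divr_ge0 ?sqr_ge0// ltW.
have I0 : (\int[mu]_x `|(quad v x)%:E| = 0)%E.
  have : \int[mu]_x quad v x = 0.
    by rewrite Rintegral_quad vG; apply: big1 => l _; rewrite mxE mulr0.
  rewrite /Rintegral => I0; under eq_integral do rewrite gee0_abs ?lee_fin//.
  by rewrite -[LHS]fineK ?I0//; exact: (integrable_fin_num measurableT (quad_int v)).
have mquad : measurable_fun setT (EFin \o quad v) by exact: measurable_int (quad_int v).
have /(ae_eq_integral_abs mu measurableT mquad) [A [mA A0 sA]] := I0.
have mroot : measurable [set x | root q x].
  have mq : measurable_fun setT (fun x => q.[x]).
    by apply: continuous_measurable_fun => x; exact: continuous_horner.
  have -> : [set x | root q x] = setT `&` (fun x => q.[x]) @^-1` [set 0].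
    by rewrite setTI; apply/seteqP; split => x /= /rootP.
  exact: mq.
have : mu setT = 0%E.
  apply/eqP; rewrite -measure_le0.
  have <- : mu (A `|` [set x | root q x]) = 0%E.
    by rewrite null_set_setU//; exact: mu_fin (finite_roots q0) _.
  apply: le_measure; rewrite ?inE//; first exact: measurableU.
  move=> x _; have [rx|rx] := boolP (root q x); [by right|left].
  apply: sA => /= /(_ I)[]; rewrite quadE -qE => /eqP.
  by rewrite mulf_eq0 sqrf_eq0 -rootE (negbTE rx)/= invr_eq0 gt_eqF.
by rewrite probability_setT => /eqP; rewrite onee_eq0.
Qed.

Lemma simple_mass_ge0 n y : 0 <= simple_mass mu n y.
Proof. exact: fine_ge0. Qed.

(* Tchakaloff-type representation: the dual family K makes every small
   perturbation of the moments realizable by nonnegative masses on [s]. *)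
Lemma atomic_even_moments :
  exists (s : seq R) (rho : R -> R) (K : 'I_k.+1 -> R -> R) (B : R),
  [/\ 0 <= B, forall y, 0 <= rho y, forall l y, `|K l y| <= B * rho y,
      forall l : 'I_k.+1, \sum_(y <- s) rho y * y ^+ (2 * l) = \int[mu]_x (x ^+ (2 * l))
    & forall l l' : 'I_k.+1, \sum_(y <- s) K l y * y ^+ (2 * l') = (l == l')%:R].
Proof.
pose G n : 'M[R]_k.+1 := \matrix_(j, l)
  \int[mu]_x (weight j (simple_norm n x) * simple_norm n x ^+ (2 * l)).
pose M : 'rV[R]_k.+1 := \row_l \int[mu]_x (`|x| ^+ (2 * l)).
pose m n : 'rV[R]_k.+1 := \row_l \int[mu]_x (simple_norm n x ^+ (2 * l)).
have GE n j l : G n j l =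
    \sum_(y <- simple_atoms n) simple_mass mu n y * (weight j y * y ^+ (2 * l)).
  by rewrite mxE (simple_integral mu n (fun y => weight j y * y ^+ (2 * l))).
have mE n l : m n 0 l = \sum_(y <- simple_atoms n) simple_mass mu n y * y ^+ (2 * l).
  by rewrite mxE (simple_integral mu n (fun y => y ^+ (2 * l))).
have GG j l : G n j l @[n --> \oo] --> gram j l.
  under eq_fun do rewrite mxE; rewrite mxE.
  exact: (cvg_simple_integral mu_int (subpoly_gram j l)).
have mM l : m n 0 l @[n --> \oo] --> M 0 l.
  under eq_fun do rewrite mxE; rewrite mxE.
  exact: (cvg_simple_integral mu_int (subpoly_pow l)).
have [uG iG] := cvg_invmx gram_unit GG.
(* Multiplying the masses by [1 + \sum_j a n 0 j * weight j y] changes the moments by [a n *m G n],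
   which is exactly the defect [M - m n] once [G n] is invertible. *)
pose a n := (M - m n) *m invmx (G n).
have a0 j : a n 0 j @[n --> \oo] --> 0.
  under eq_fun do rewrite mxE.
  suff : \sum_l (M - m n) 0 l * invmx (G n) l j @[n --> \oo] -->
      \sum_l (M 0 l - M 0 l) * invmx gram l j.
    by rewrite [X in _ --> X]big1// => l _; rewrite subrr mul0r.
  apply: cvg_sumr => l; apply: cvgM; last exact: iG.
  suff : M 0 l - m n 0 l @[n --> \oo] --> M 0 l - M 0 l.
    by apply: cvg_trans; apply: near_eq_cvg; apply: nearW => n; rewrite !mxE.
  by apply: cvgB; [exact: cvg_cst|exact: mM].
(* With [k.+1] weights bounded by 1, the correction is at most 1/2 in absolute value, so [rho] keeps
   at least half of the mass [w]. *)
pose e : R := (2 * k.+1%:R)^-1.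
have e0 : 0 < e by rewrite invr_gt0.
have [n [uGn an]] : exists n, G n \in unitmx /\ forall j, `|a n 0 j| <= e.
  have : \forall n \near \oo, G n \in unitmx /\ forall j, `|a n 0 j| <= e.
    have aN j : \forall n \near \oo, `|a n 0 j| <= e.
      by apply: (cvgr0_norm_le (fun n => a n 0 j)) => //; exact: a0.
    by apply: filterS2 uG (filter_forall _ aN) => n.
  exact: filter_ex.
pose w y := simple_mass mu n y; have w0 y : 0 <= w y by exact: simple_mass_ge0.
pose rho y := w y * (1 + \sum_j a n 0 j * weight j y).
(* Reweighting by row [l] of the inverse matrix produces the unit vector [l] as vector of even
   moments. *)
pose K (l : 'I_k.+1) y := w y * \sum_j invmx (G n) l j * weight j y.
pose B0 := \sum_l \sum_j `|invmx (G n) l j|.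
have B00 : 0 <= B0 by apply: sumr_ge0 => l _; apply: sumr_ge0.
have rho_ge y : w y <= 2 * rho y.
  rewrite /rho mulrCA ler_peMr//.
  suff : - (2^-1) <= \sum_j a n 0 j * weight j y by lra.
  rewrite lerNl -sumrN (_ : 2^-1 = \sum_(j < k.+1) e); last first.
    by rewrite sumr_const card_ord -[e *+ _]mulr_natr /e invfM mulfVK// pnatr_eq0.
  apply: ler_sum => j _; rewrite (le_trans (ler_norm _))// normrN normrM.
  by rewrite -[leRHS]mulr1 ler_pM// weight_bound.
(* [B0] dominates every row sum of the inverse matrix, and the factor 2 comes from
   [w y <= 2 * rho y]. *)
exists (simple_atoms n), rho, K, (2 * B0); split.
- by rewrite mulr_ge0.
- by move=> y; have := rho_ge y; have := w0 y; lra.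
- move=> l y; apply: (@le_trans _ _ (w y * B0)); last first.
    by have := rho_ge y; nra.
  rewrite normrM ger0_norm// ler_wpM2l// (le_trans (ler_norm_sum _ _ _))//.
  rewrite /B0 [leRHS](bigD1 l)//= ler_wpDr ?sumr_ge0// => [i _|]; first exact: sumr_ge0.
  apply: ler_sum => j _; rewrite normrM -[leRHS]mulr1 ler_pM// weight_bound//.
- move=> l; rewrite (_ : \int[mu]_x _ = M 0 l); last first.
    by rewrite mxE; apply: eq_Rintegral => x _; rewrite normr_even_pow.
  have -> : M 0 l = m n 0 l + (a n *m G n) 0 l.
    by rewrite mulmxKV// !mxE subrKC.
  rewrite mE mxE /rho.
  under eq_bigr do rewrite mulrDr mulr1 mulrDl.
  rewrite big_split/=; congr (_ + _).
  under [RHS]eq_bigr do rewrite GE mulr_sumr.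
  rewrite exchange_big/=; apply: eq_bigr => y _; rewrite -mulrA mulr_suml mulr_sumr.
  by apply: eq_bigr => j _; rewrite /w; ring.
- move=> l l'; rewrite (_ : (l == l')%:R = (invmx (G n) *m G n) l l'); last first.
    by rewrite mulVmx// mxE.
  rewrite mxE; under [RHS]eq_bigr do rewrite GE mulr_sumr.
  rewrite exchange_big/=; apply: eq_bigr => y _; rewrite -mulrA mulr_suml mulr_sumr.
  by apply: eq_bigr => j _; rewrite /w; ring.
Qed.

End gram.

(** * Finitely supported product measures *)

Section atomic_probability.
Context d (T : measurableType d) (R : realType) (I : finType).
Variables (w : I -> R) (v : I -> T).
Hypotheses (w0 : forall i, 0 <= w i) (w1 : \sum_i w i = 1).

(** [msum] takes a family indexed by natural numbers: [I] is enumerated, with the zero measure as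
    default past its cardinal. *)
Let atom (n : nat) : {measure set T -> \bar R} :=
  if insub n is Some i then mscale (NngNum (w0 (enum_val i))) \d_(v (enum_val (i : 'I_#|I|)))
  else mzero.

Definition atomic_prob := msum atom #|I|.

HB.instance Definition _ := Measure.on atomic_prob.

Let ge0_integral_atomic (f : T -> \bar R) :
  measurable_fun setT f -> (forall x, 0 <= f x)%E ->
  (\int[atomic_prob]_x f x = \sum_i (w i)%:E * f (v i))%E.
Proof.
move=> mf f0; rewrite /atomic_prob ge0_integral_measure_sum//.
rewrite [RHS](reindex_onto (@enum_val I predT) enum_rank)/=; last first.
  by move=> i _; rewrite enum_rankK.
under [RHS]eq_bigl do rewrite enum_valK eqxx.
apply: eq_bigr => i _; rewrite /atom insubT//= => iI.
rewrite ge0_integral_mscale// integral_dirac// diracT mul1e.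
by rewrite (_ : Sub _ _ = i)//; exact: val_inj.
Qed.

Let atomic_setT : atomic_prob setT = 1%E.
Proof.
rewrite -[LHS]mul1e -integral_cst// ge0_integral_atomic//=.
by under eq_bigr do rewrite mule1; rewrite sumEFin w1.
Qed.

HB.instance Definition _ := @Measure_isProbability.Build _ _ R atomic_prob atomic_setT.

Definition atomic_probability : probability T R := atomic_prob.

Lemma integral_atomic (f : T -> R) : measurable_fun setT f ->
  atomic_probability.-integrable setT (EFin \o f) /\
  \int[atomic_probability]_x f x = \sum_i w i * f (v i).
Proof.
move=> mf; have mEf : measurable_fun setT (EFin \o f) by exact/measurable_EFinP.
split.
  apply/integrableP; split => //; rewrite ge0_integral_atomic//.
    by under eq_bigr do rewrite /= -EFinM; rewrite sumEFin ltry.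
  exact: measurableT_comp.
rewrite /Rintegral integralE !ge0_integral_atomic//; last 2 first.
- exact: measurable_funeneg.
- exact: measurable_funepos.
rewrite funerpos funerneg.
under eq_bigr do rewrite /= -EFinM; under [X in (_ - X)%E]eq_bigr do rewrite /= -EFinM.
rewrite !sumEFin -EFinB/= -sumrB; apply: eq_bigr => i _.
by rewrite -mulrBr -[in RHS](funrposBneg f).
Qed.

End atomic_probability.

Section measurability_Rn.
Context {R : realType} (N : nat).

Lemma continuous_measurable_Rn (f : 'rV[R]_N -> R) :
  continuous f -> measurable_fun [set: @borel_Rn R N] f.
Proof.
move=> cf; apply: (measurability _ (RGenOpens.measurableE R)).
move=> _ [_ [a [b ->]] <-]; rewrite setTI; apply: sub_sigma_algebra.
by move/continuousP : cf; apply; exact: interval_open.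
Qed.

Lemma measurable_coord (j : 'I_N) :
  measurable_fun [set: @borel_Rn R N] (fun v : 'rV[R]_N => v 0 j).
Proof. by apply: continuous_measurable_Rn; exact: coord_continuous. Qed.

Lemma measurable_monomial b : measurable_fun [set: @borel_Rn R N] (monomial b).
Proof.
apply: measurable_prod => j _; apply: measurable_funX.
exact: measurable_coord.
Qed.

Lemma measurable_dotp x : measurable_fun [set: @borel_Rn R N] (dotp x).
Proof.
apply: measurable_sum => j; apply: measurable_funM => //.
exact: measurable_coord.
Qed.

Lemma measurable_cos_dotp x :
  measurable_fun [set: @borel_Rn R N] (fun v : 'rV[R]_N => cos (dotp x v)).
Proof.
apply: (measurableT_comp (f := @cos R)); last exact: measurable_dotp.
by apply: continuous_measurable_fun; exact: continuous_cos.
Qed.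

Lemma measurable_sin_dotp x :
  measurable_fun [set: @borel_Rn R N] (fun v : 'rV[R]_N => sin (dotp x v)).
Proof.
apply: (measurableT_comp (f := @sin R)); last exact: measurable_dotp.
by apply: continuous_measurable_fun; exact: continuous_sin.
Qed.

End measurability_Rn.

Section product_measure.
Context {R : realType} (N : nat) (I J : finType) (j0 : 'I_N).
Variables (la : I -> R) (x : I -> R) (rho : J -> R) (y : J -> R).
Hypotheses (la0 : forall i, 0 <= la i) (la1 : \sum_i la i = 1).
Hypotheses (rho0 : forall i, 0 <= rho i) (rho1 : \sum_i rho i = 1).

Definition prod_weight (p : I * {ffun 'I_N -> J}) : R :=
  la p.1 * \prod_(j < N) rho (p.2 j).

(* The coordinate [p.2 j0] is not used: its mass is summed out. *)
Definition prod_atom (p : I * {ffun 'I_N -> J}) : 'rV[R]_N :=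
  \row_j if j == j0 then x p.1 else y (p.2 j).

Let rho_prod1 : \sum_(g : {ffun 'I_N -> J}) \prod_(j < N) rho (g j) = 1.
Proof.
rewrite -(bigA_distr_bigA (fun _ : 'I_N => rho)) /=.
by rewrite big1// => j _; exact: rho1.
Qed.

Lemma prod_weight_ge0 p : 0 <= prod_weight p.
Proof. by rewrite mulr_ge0// prodr_ge0. Qed.

Lemma prod_weight1 : \sum_p prod_weight p = 1.
Proof.
rewrite -(pair_bigA _ (fun i (g : {ffun 'I_N -> J}) => la i * \prod_(j < N) rho (g j)))/=.
by under eq_bigr do rewrite -mulr_sumr rho_prod1 mulr1.
Qed.

Definition prod_prob : probability (@borel_Rn R N) R :=
  @atomic_probability _ (@borel_Rn R N) R _ prod_weight prod_atom prod_weight_ge0 prod_weight1.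

Lemma integral_prod_prob (f : 'rV[R]_N -> R) : measurable_fun [set: @borel_Rn R N] f ->
  prod_prob.-integrable setT (EFin \o f) /\
  \int[prod_prob]_v f v = \sum_p prod_weight p * f (prod_atom p).
Proof. exact: integral_atomic. Qed.

Lemma prod_moment b :
  \sum_p prod_weight p * monomial b (prod_atom p) =
  \prod_(j < N) (if j == j0 then \sum_i la i * x i ^+ b j else \sum_i rho i * y i ^+ b j).
Proof.
(* When the sum over [g] is factored by coordinates, position [j0] yields the total mass of [rho],
   that is 1. *)
pose h j := if j == j0 then \sum_i rho i else \sum_i rho i * y i ^+ b j.
have hE : \sum_(g : {ffun 'I_N -> J})
    \prod_(j < N) (rho (g j) * if j == j0 then 1 else y (g j) ^+ b j) = \prod_j h j.
  rewrite -(bigA_distr_bigA (fun j a => rho a * if j == j0 then 1 else y a ^+ b j))/=.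
  apply: eq_bigr => j _; rewrite /h; case: eqP => // _.
  by apply: eq_bigr => i _; rewrite mulr1.
rewrite [RHS](bigD1 j0)//= eqxx.
transitivity ((\sum_i la i * x i ^+ b j0) * \prod_j h j); last first.
  congr (_ * _); rewrite (bigD1 j0)//= /h eqxx rho1 mul1r.
  by apply: eq_bigr => j /negbTE ->.
rewrite -hE mulr_suml.
rewrite -(pair_bigA _ (fun i (g : {ffun 'I_N -> J}) => prod_weight (i, g) * monomial b (prod_atom (i, g))))/=.
apply: eq_bigr => i _; rewrite mulr_sumr; apply: eq_bigr => g _.
rewrite /prod_weight /= big_split/= -!mulrA; congr (_ * _).
rewrite mulrCA; congr (_ * _).
rewrite /monomial (bigD1 j0)//= [in RHS](bigD1 j0)//= mxE eqxx mul1r; congr (_ * _).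
by apply: eq_bigr => j /negbTE jj0; rewrite mxE jj0.
Qed.

Hypothesis la_odd : forall f : R -> R, (forall z, f (- z) = - f z) -> \sum_i la i * f (x i) = 0.

Let rest (u : 'rV[R]_N) (g : {ffun 'I_N -> J}) : R := \sum_(j < N | j != j0) u 0 j * y (g j).

Let dotp_atom u i g : dotp u (prod_atom (i, g)) = u 0 j0 * x i + rest u g.
Proof.
rewrite /dotp (bigD1 j0)//= mxE eqxx; congr (_ + _).
by apply: eq_bigr => j /negbTE jj0; rewrite mxE jj0.
Qed.

(** Real part of the Fourier transform of the coordinates other than [j0]; [rest_sin] is the
    opposite of its imaginary part. *)
Definition rest_cos u := \sum_(g : {ffun 'I_N -> J}) (\prod_(j < N) rho (g j)) * cos (rest u g).
Definition rest_sin u := \sum_(g : {ffun 'I_N -> J}) (\prod_(j < N) rho (g j)) * sin (rest u g).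

Definition marginal_cos (t : R) : R := \sum_i la i * cos (t * x i).

Let sin_sum0 (a : R) : \sum_i la i * sin (a * x i) = 0.
Proof. by apply: (la_odd (f := fun z => sin (a * z))) => z; rewrite mulrN sinN. Qed.

(* The first marginal is symmetric, hence its Fourier transform is real. *)
Lemma fourier_prod u : fourier prod_prob u =
  Complex (marginal_cos (u 0 j0) * rest_cos u) (- (marginal_cos (u 0 j0) * rest_sin u)).
Proof.
rewrite /fourier; congr Complex; [|congr (- _)].
  have [_ ->] := integral_prod_prob (measurable_cos_dotp u).
  rewrite -(pair_bigA _ (fun i (g : {ffun 'I_N -> J}) => prod_weight (i, g) * cos (dotp u (prod_atom (i, g)))))/=.
  rewrite exchange_big/= /rest_cos mulr_sumr; apply: eq_bigr => g _.
  rewrite /marginal_cos mulrCA mulr_suml.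
  under eq_bigr => i _.
    rewrite dotp_atom cosD /prod_weight /= mulrBr.
    rewrite (_ : _ - _ = (\prod_(j < N) rho (g j)) * (la i * cos (u 0 j0 * x i) * cos (rest u g)) -
       (\prod_(j < N) rho (g j)) * sin (rest u g) * (la i * sin (u 0 j0 * x i))); last by ring.
    over.
  by rewrite sumrB -[X in _ - X]mulr_sumr sin_sum0 mulr0 subr0 -mulr_sumr.
have [_ ->] := integral_prod_prob (measurable_sin_dotp u).
rewrite -(pair_bigA _ (fun i (g : {ffun 'I_N -> J}) => prod_weight (i, g) * sin (dotp u (prod_atom (i, g)))))/=.
rewrite exchange_big/= /rest_sin mulr_sumr; apply: eq_bigr => g _.
rewrite /marginal_cos mulrCA mulr_suml.
under eq_bigr => i _.
  rewrite dotp_atom sinD /prod_weight /= mulrDr.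
  rewrite (_ : _ + _ = (\prod_(j < N) rho (g j)) * cos (rest u g) * (la i * sin (u 0 j0 * x i)) +
    (\prod_(j < N) rho (g j)) * (la i * cos (u 0 j0 * x i) * sin (rest u g))); last by ring.
  over.
by rewrite big_split/= -mulr_sumr sin_sum0 mulr0 add0r -mulr_sumr.
Qed.

Let prob_bound (f : R -> R) u : (forall z, `|f z| <= 1) ->
  `|\sum_(g : {ffun 'I_N -> J}) (\prod_(j < N) rho (g j)) * f (rest u g)| <= 1.
Proof.
move=> f1; rewrite -[leRHS]rho_prod1 (le_trans (ler_norm_sum _ _ _))// ler_sum// => g _.
by rewrite normrM ger0_norm ?prodr_ge0// ler_piMr ?prodr_ge0.
Qed.

Lemma rest_cos_le1 u : `|rest_cos u| <= 1.
Proof. by apply: prob_bound => z; rewrite ler_norml cos_geN1 cos_le1. Qed.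

Lemma rest_sin_le1 u : `|rest_sin u| <= 1.
Proof. by apply: prob_bound => z; rewrite ler_norml sin_geN1 sin_le1. Qed.

Lemma rest_cos_axis (t : R) : rest_cos (\row_j if j == j0 then t else 0) = 1.
Proof.
rewrite /rest_cos -[RHS]rho_prod1; apply: eq_bigr => g _.
rewrite /rest [X in cos X]big1 ?cos0 ?mulr1// => j /negbTE jj0.
by rewrite mxE jj0 mul0r.
Qed.

End product_measure.

(** * Perturbations with growing odd moment *)

(** Since only the cosine and even powers occur, integrals of the remainder are determined by the
    cosine transform and the even moments up to order 2m. *)
Lemma cos_rem_closed (R : realType) m : exists c : nat -> R, forall u,
  cos_rem m u = (-1) ^+ m.+1 * cos u + \sum_(l < m.+1) c l * u ^+ (2 * l).
Proof.
elim: m => [|m [c IH]].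
  exists (fun=> 1) => u; rewrite big_ord_recl big_ord0 /= muln0 expr0; ring.
exists (fun l => if l == m.+1 then (2 * m.+1)`!%:R^-1 else - c l) => u.
rewrite cos_remS IH [in RHS]big_ord_recr/= eqxx [(-1) ^+ m.+2]exprS mulN1r.
under [X in _ = _ + (X + _)]eq_bigr => l _.
  rewrite ifN ?mulNr; last by rewrite neq_ltn ltn_ord.
  over.
rewrite sumrN; ring.
Qed.

Lemma sum_half_le (R : realFieldType) p : \sum_(i < p) (2 ^+ i)^-1 <= 2 :> R.
Proof.
suff -> : \sum_(i < p) (2 ^+ i)^-1 = 2 - 2 * (2 ^+ p)^-1 :> R.
  by rewrite gerBl mulr_ge0// invr_ge0 exprn_ge0.
elim: p => [|p IH]; first by rewrite big_ord0 expr0 invr1 mulr1 subrr.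
by rewrite big_ord_recr/= IH exprS; field; rewrite expf_neq0.
Qed.

(** From index [q] on, 1/(i+1) is at most 1/(q+1); this is the source of the Cauchy rate. *)
Lemma sum_tail_le (R : realFieldType) (a : nat -> R) q p : (forall i, 0 <= a i) ->
  \sum_(q <= i < p) a i / i.+1%:R <= (\sum_(i < p) a i) / q.+1%:R.
Proof.
move=> a0; have [pq|/ltnW qp] := leqP p q.
  by rewrite big_geq// divr_ge0// sumr_ge0.
rewrite -(big_mkord xpredT) (big_cat_nat (n := q) (m := 0))//= mulrDl ler_wpDl//.
  by rewrite divr_ge0// sumr_ge0.
rewrite mulr_suml; apply: ler_sum_nat => i /andP[qi _].
by rewrite ler_wpM2l// lef_pV2 ?posrE// ler_nat.
Qed.

Section perturbed_functionals.
Context {R : realType} (k : nat).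
Variables (s : seq R) (rho : R -> R) (K : 'I_k.+2 -> R -> R) (B : R) (M : nat -> R).
Hypotheses (B0 : 0 <= B) (rho0 : forall y, 0 <= rho y).
Hypothesis K_le : forall l y, `|K l y| <= B * rho y.
Hypothesis rhoM : forall l : 'I_k.+2, \sum_(y <- s) rho y * y ^+ (2 * l) = M l.
Hypothesis K_dual : forall l l' : 'I_k.+2, \sum_(y <- s) K l y * y ^+ (2 * l') = (l == l')%:R.

(* In this section k is one less than in the theorem. The masses at 2^i: their
   moments of order 2k+3 form the harmonic series, those of lower order are
   summable. *)
Definition far_mass i : R := (2 ^+ i) ^- (2 * k.+1).+1 / i.+1%:R.
(** The far moments are at most 2 and the [k.+2] correctors are bounded by [B * rho], so this factor
    keeps [near_mass] nonnegative; the summand 1 covers [B = 0]. *)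
Definition scale : R := (2 * B * k.+2%:R + 1)^-1.
Definition far_moment p l : R := \sum_(i < p) far_mass i * (2 ^+ i) ^+ (2 * l).
(** By duality of [K], the subtracted term has the same even moments up to order 2k+2 as the
    rescaled far masses, and the two cancel. *)
Definition near_mass p y : R := rho y - scale * \sum_(l < k.+2) K l y * far_moment p l.

(** Integral against the perturbed measure of index [p], before symmetrization. *)
Definition functional p (f : R -> R) : R :=
  \sum_(y <- s) near_mass p y * f y + scale * \sum_(i < p) far_mass i * f (2 ^+ i).

Lemma scale_gt0 : 0 < scale.
Proof. by rewrite invr_gt0 ltr_wpDl// !mulr_ge0. Qed.

Let pow2_gt0 i : 0 < 2 ^+ i :> R. Proof. exact: exprn_gt0. Qed.

Lemma far_mass_gt0 i : 0 < far_mass i.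
Proof. by rewrite divr_gt0// invr_gt0 exprn_gt0. Qed.

Let far_mass_pow (l : 'I_k.+2) i :
  far_mass i * (2 ^+ i) ^+ (2 * l) <= (2 ^+ i)^-1 / i.+1%:R.
Proof.
rewrite /far_mass mulrAC ler_wpM2r// exprS invfM -mulrA ler_piMr//.
rewrite mulrC ler_pdivrMr ?exprn_gt0// mul1r ler_weXn2l//.
  by rewrite exprn_ege1// ler1n.
by have := ltn_ord l; lia.
Qed.

Lemma far_moment_ge0 p l : 0 <= far_moment p l.
Proof. by apply: sumr_ge0 => i _; rewrite mulr_ge0 ?exprn_ge0 ?ltW// far_mass_gt0. Qed.

Let far_moment_diff q p (l : 'I_k.+2) : (q <= p)%N ->
  0 <= far_moment p l - far_moment q l <= 2 / q.+1%:R.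
Proof.
move=> qp; rewrite /far_moment -!(big_mkord xpredT (fun i => far_mass i * (2 ^+ i) ^+ (2 * l))).
rewrite (big_cat_nat (n := q))//= addrAC subrr add0r; apply/andP; split.
  by apply: sumr_ge0 => i _; rewrite mulr_ge0 ?exprn_ge0 ?ltW// far_mass_gt0.
apply: (@le_trans _ _ (\sum_(q <= i < p) (2 ^+ i)^-1 / i.+1%:R)).
  by apply: ler_sum => i _; exact: far_mass_pow.
apply: (le_trans (sum_tail_le _ _ _)).
  by move=> i; rewrite invr_ge0 ltW.
by rewrite ler_wpM2r// sum_half_le.
Qed.

Let far_moment_le p (l : 'I_k.+2) : far_moment p l <= 2.
Proof.
have /andP[_] := far_moment_diff l (leq0n p).
by rewrite [far_moment 0 l]big_ord0 subr0 divr1.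
Qed.

Lemma near_mass_ge0 p y : 0 <= near_mass p y.
Proof.
rewrite subr_ge0 /scale mulrC ler_pdivrMr; last by rewrite ltr_wpDl// !mulr_ge0.
apply: (@le_trans _ _ (\sum_(l < k.+2) B * rho y * 2)).
  apply: ler_sum => l _; apply: (le_trans (ler_norm _)).
  rewrite normrM ler_pM// ger0_norm ?far_moment_ge0// far_moment_le.
rewrite sumr_const card_ord -[_ *+ _]mulr_natr.
have := rho0 y; have := ler0n R k.+2; nra.
Qed.

Lemma functional_pow p (l : 'I_k.+2) : functional p (fun y => y ^+ (2 * l)) = M l.
Proof.
rewrite /functional -/(far_moment p l) /near_mass.
under eq_bigr do rewrite mulrBl.
rewrite sumrB rhoM -addrA; apply/eqP; rewrite -subr_eq0 addrAC subrr add0r; apply/eqP.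
under eq_bigr do rewrite -mulrA mulr_suml.
rewrite -mulr_sumr exchange_big/=.
under eq_bigr => l' _.
  under eq_bigr do rewrite mulrAC.
  rewrite -mulr_suml K_dual.
  over.
rewrite (bigD1 l)//= eqxx mul1r big1 ?addr0 ?addNr// => l' /negbTE ->.
by rewrite mul0r.
Qed.

Lemma functionalD p f g : functional p (fun y => f y + g y) = functional p f + functional p g.
Proof.
rewrite /functional; under eq_bigr do rewrite mulrDr.
under [X in _ + _ * X = _]eq_bigr do rewrite mulrDr.
by rewrite !big_split/= mulrDr; ring.
Qed.

Lemma functionalZ p a f : functional p (fun y => a * f y) = a * functional p f.
Proof.
rewrite /functional mulrDr mulrCA !mulr_sumr; congr (_ + _).
  by apply: eq_bigr => y _; rewrite mulrCA.
by apply: eq_bigr => y _; ring.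
Qed.

Lemma functional_sum p n (f : nat -> R -> R) :
  functional p (fun y => \sum_(i < n) f i y) = \sum_(i < n) functional p (f i).
Proof.
elim: n => [|n IH].
  rewrite big_ord0 /functional; under eq_bigr do rewrite big_ord0 mulr0.
  by under [X in _ + _ * X]eq_bigr do rewrite big_ord0 mulr0; rewrite !big1_eq mulr0 addr0.
rewrite big_ord_recr/= -IH -functionalD.
by rewrite /functional; congr (_ + _ * _); apply: eq_bigr => y _; rewrite big_ord_recr.
Qed.

Lemma eq_functional p f g : f =1 g -> functional p f = functional p g.
Proof. by move=> /funext ->. Qed.

Lemma functional_ge_far p f m : (forall y, 0 <= f y) -> (m < p)%N ->
  scale * (far_mass m * f (2 ^+ m)) <= functional p f.
Proof.
move=> f0 mp; rewrite /functional ler_wpDl//.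
  by apply: sumr_ge0 => y _; rewrite mulr_ge0 ?near_mass_ge0.
rewrite ler_pM2l ?scale_gt0// (bigD1 (Ordinal mp))//= ler_wpDr// sumr_ge0// => i _.
by rewrite mulr_ge0// ltW// far_mass_gt0.
Qed.

Definition near_bound : R := \sum_(y <- s) \sum_(l < k.+2) `|K l y| * `|y| ^+ (2 * k.+1).+1.

(** The factor 2^(-i(2k+3)) of [far_mass] cancels the power in [cos_rem_le_min], leaving |t|^(2k+3)
    times dyadic minima divided by i+1. *)
Let far_cos_rem q p t : t != 0 ->
  \sum_(q <= i < p) far_mass i * cos_rem k.+1 (t * 2 ^+ i) <=
  `|t| ^+ (2 * k.+1).+1 * (4 / q.+1%:R).
Proof.
move=> t0; have t0' : 0 < `|t| by rewrite normr_gt0.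
pose a i := Num.min (`|t| * 2 ^+ i) (`|t| * 2 ^+ i)^-1.
have a0 i : 0 <= a i.
  by rewrite le_min invr_ge0 andbb mulr_ge0// ltW.
apply: (@le_trans _ _ (\sum_(q <= i < p) `|t| ^+ (2 * k.+1).+1 * (a i / i.+1%:R))).
  apply: ler_sum => i _.
  have -> : cos_rem k.+1 (t * 2 ^+ i) = cos_rem k.+1 (`|t| * 2 ^+ i).
    by case: (ger0P t) => // _; rewrite mulNr cos_remN.
  have := @cos_rem_le_min _ k (`|t| * 2 ^+ i); rewrite -/(a i) exprMn => H.
  apply: (@le_trans _ _ (far_mass i * (`|t| ^+ (2 * k.+1).+1 * (2 ^+ i) ^+ (2 * k.+1).+1 * a i))).
    by rewrite ler_pM2l ?far_mass_gt0// H// mulr_gt0.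
  rewrite /far_mass le_eqVlt; apply/orP; left; apply/eqP; field.
  by rewrite nat1r pnatr_eq0/= !expf_neq0.
rewrite -mulr_sumr ler_wpM2l ?exprn_ge0//.
apply: (le_trans (sum_tail_le _ _ a0)).
by rewrite ler_wpM2r// dyadic_sum_le.
Qed.

(** The bound does not depend on [p]. The 4 comes from the far masses of index at least [q];
    [2 * near_bound] comes from the change of the correction on the fixed support, where the
    remainder is at most |t y|^(2k+3). *)
Lemma functional_cos_rem_diff q p t : (q <= p)%N ->
  `|functional p (fun y => cos_rem k.+1 (t * y)) -
    functional q (fun y => cos_rem k.+1 (t * y))| <=
  `|t| ^+ (2 * k.+1).+1 * (scale * (4 + 2 * near_bound) / q.+1%:R).
Proof.
move=> qp; set f := fun y => _.
have f0 y : 0 <= f y by exact: cos_rem_ge0.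
have [t0|t0] := eqVneq t 0.
  have fE y : f y = 0 by rewrite /f t0 mul0r cos_rem0.
  have fz p' : functional p' f = 0.
    rewrite /functional big1 ?add0r => [|y _]; last by rewrite fE mulr0.
    by rewrite big1 ?mulr0// => i _; rewrite fE mulr0.
  by rewrite !fz subrr normr0 t0 normr0 expr0n mul0r.
have -> : functional p f - functional q f =
    scale * (\sum_(q <= i < p) far_mass i * f (2 ^+ i) -
      \sum_(y <- s) \sum_(l < k.+2) K l y * (far_moment p l - far_moment q l) * f y).
  rewrite /functional -!(big_mkord xpredT (fun i => far_mass i * f (2 ^+ i))).
  rewrite (big_cat_nat (n := q) (m := 0) (p := p))//=.
  rewrite (_ : \sum_(y <- s) \sum_(l < k.+2) _ =
     scale^-1 * (\sum_(y <- s) near_mass q y * f y - \sum_(y <- s) near_mass p y * f y)).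
    by field; rewrite gt_eqF ?scale_gt0.
  rewrite -sumrB mulr_sumr; apply: eq_bigr => y _.
  rewrite -mulrBl (_ : near_mass q y - near_mass p y = scale *
    (\sum_(l < k.+2) K l y * far_moment p l - \sum_(l < k.+2) K l y * far_moment q l)); last first.
    by rewrite /near_mass; ring.
  rewrite mulrA mulKf ?gt_eqF ?scale_gt0//.
  rewrite -sumrB mulr_suml; apply: eq_bigr => l _.
  by rewrite [K l y * (_ - _)]mulrBr.
rewrite normrM gtr0_norm ?scale_gt0// -mulrA mulrCA ler_pM2l ?scale_gt0//.
apply: (le_trans (ler_normB _ _)); rewrite mulrDl mulrDr lerD//.
  rewrite ger0_norm; first exact: far_cos_rem.
  by apply: sumr_ge0 => i _; rewrite mulr_ge0// ltW// far_mass_gt0.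
rewrite [leRHS](_ : _ = `|t| ^+ (2 * k.+1).+1 * (2 / q.+1%:R) * near_bound); last by ring.
rewrite [leRHS]mulr_sumr (le_trans (ler_norm_sum _ _ _))// ler_sum// => y _.
rewrite [leRHS]mulr_sumr (le_trans (ler_norm_sum _ _ _))// ler_sum// => l _.
have /andP[d0 d2] := far_moment_diff l qp.
rewrite !normrM (ger0_norm d0) (ger0_norm (f0 y)).
rewrite [leRHS](_ : _ = `|K l y| * (2 / q.+1%:R) * (`|t| ^+ (2 * k.+1).+1 * `|y| ^+ (2 * k.+1).+1)); last by ring.
rewrite -exprMn -normrM ler_pM ?mulr_ge0//; last exact: cos_rem_le_odd.
by rewrite ler_wpM2l.
Qed.

(* Each point is split evenly between itself and its opposite. *)
Definition atom_index p := ((('I_(size s) + 'I_p) * bool)%type : finType).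

Definition index_mass p (i : atom_index p) : R :=
  (match i.1 with inl a => near_mass p s`_a | inr b => scale * far_mass b end) / 2.

Definition index_atom p (i : atom_index p) : R :=
  (-1) ^+ i.2 * (match i.1 with inl a => s`_a | inr b => 2 ^+ b end).

Lemma index_mass_ge0 p i : 0 <= @index_mass p i.
Proof.
rewrite divr_ge0//; case: i.1 => a; first exact: near_mass_ge0.
by rewrite ltW// mulr_gt0 ?scale_gt0 ?far_mass_gt0.
Qed.

Lemma sum_index p f : \sum_i @index_mass p i * f (index_atom i) =
  functional p (fun y => (f y + f (- y)) / 2).
Proof.
rewrite -(pair_bigA _ (fun i b => @index_mass p (i, b) * f (@index_atom p (i, b))))/=.
rewrite big_sumType/= /functional; congr (_ + _).
  rewrite (big_nth 0) big_mkord; apply: eq_bigr => a _.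
  by rewrite big_bool /index_mass /index_atom /= expr1 expr0 mul1r mulN1r; ring.
rewrite mulr_sumr; apply: eq_bigr => a _.
by rewrite big_bool /index_mass /index_atom /= expr1 expr0 mul1r mulN1r; ring.
Qed.

Lemma sum_index_odd p f : (forall y, f (- y) = - f y) ->
  \sum_i @index_mass p i * f (index_atom i) = 0.
Proof.
move=> fN; rewrite sum_index (eq_functional _ (g := fun y => 0 * f y)).
  by rewrite functionalZ mul0r.
by move=> y; rewrite fN subrr !mul0r.
Qed.

Lemma sum_index_even p f : (forall y, f (- y) = f y) ->
  \sum_i @index_mass p i * f (index_atom i) = functional p f.
Proof.
move=> fN; rewrite sum_index; apply: eq_functional => y.
by rewrite fN -mulr2n -[_ *+ 2]mulr_natr mulfK.
Qed.

End perturbed_functionals.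

(** * The Fourier metric and the limit *)

Section norms.
Context {R : realType}.

Lemma normc_le (a b : R) : ComplexField.Normc.normc (Complex a b) <= `|a| + `|b|.
Proof.
rewrite /= -[leRHS]ger0_norm ?addr_ge0// -sqrtr_sqr ler_wsqrtr//.
rewrite sqrrD !real_normK ?num_real// lerD2r lerDl.
by rewrite mulrn_wge0// mulr_ge0.
Qed.

Lemma le_normc_Re (a b : R) : `|a| <= ComplexField.Normc.normc (Complex a b).
Proof. by rewrite /= -sqrtr_sqr ler_wsqrtr// lerDl sqr_ge0. Qed.

Lemma norm2_ge (N : nat) (u : 'rV[R]_N) j : `|u 0 j| <= norm2 u.
Proof.
rewrite /norm2 -sqrtr_sqr ler_wsqrtr// /dotp (bigD1 j)//= -expr2 lerDl sumr_ge0// => i _.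
by rewrite -expr2 sqr_ge0.
Qed.

Lemma norm2_axis (N : nat) (j : 'I_N) (t : R) :
  norm2 (\row_i if i == j then t else 0) = `|t|.
Proof.
rewrite /norm2 /dotp (bigD1 j)//= mxE eqxx big1 ?addr0 -?expr2 ?sqrtr_sqr// => i /negbTE ij.
by rewrite mxE ij mul0r.
Qed.

Lemma norm2_gt0 (N : nat) (u : 'rV[R]_N) : u != 0 -> 0 < norm2 u.
Proof.
move=> u0; have [j uj] : exists j, u 0 j != 0.
  apply: contrapT => H; move/negP: u0; apply; apply/eqP/rowP => j; rewrite mxE.
  by apply/eqP/negPn/negP => uj; apply: H; exists j.
by apply: lt_le_trans (norm2_ge u j); rewrite normr_gt0.
Qed.

End norms.

(** The other marginals coincide, so the difference of the marginal transforms factors out of the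
    real and the imaginary part; each cofactor is at most 1, whence the 2. *)
Lemma fourier_dist_prod_le (R : realType) N (I1 I2 J : finType) (j0 : 'I_N)
    (la1 x1 : I1 -> R) (la2 x2 : I2 -> R) (rho y : J -> R)
    (p1 : forall i, 0 <= la1 i) (s1 : \sum_i la1 i = 1)
    (p2 : forall i, 0 <= la2 i) (s2 : \sum_i la2 i = 1)
    (p : forall i, 0 <= rho i) (s : \sum_i rho i = 1) (n : nat) (e : R) :
  (forall f : R -> R, (forall z, f (- z) = - f z) -> \sum_i la1 i * f (x1 i) = 0) ->
  (forall f : R -> R, (forall z, f (- z) = - f z) -> \sum_i la2 i * f (x2 i) = 0) ->
  (forall t, `|marginal_cos la1 x1 t - marginal_cos la2 x2 t| <= `|t| ^+ n * e) ->
  (fourier_dist n (prod_prob j0 x1 y p1 s1 p s) (prod_prob j0 x2 y p2 s2 p s) <= (2 * e)%:E)%E.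
Proof.
move=> o1 o2 H; apply: ge_ereal_sup => _ [u u0 <-].
rewrite lee_fin !fourier_prod// ler_pdivrMr ?exprn_gt0 ?norm2_gt0//.
set c1 := marginal_cos la1 _ _; set c2 := marginal_cos la2 _ _.
set A := rest_cos _ _ _ _; set B := rest_sin _ _ _ _.
have Hc : `|c1 - c2| <= e * norm2 u ^+ n.
  apply: (le_trans (H _)); rewrite mulrC ler_wpM2l//.
    have := H 1; rewrite normr1 expr1n mul1r; exact: le_trans.
  by rewrite lerXn2r ?nnegrE ?norm2_ge// sqrtr_ge0.
have -> : (Complex (c1 * A) (- (c1 * B)) - Complex (c2 * A) (- (c2 * B)) =
  Complex ((c1 - c2) * A) (- ((c1 - c2) * B)))%R.
  by apply/eqP; rewrite eq_complex /=; apply/andP; split; apply/eqP; ring.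
apply: (le_trans (normc_le _ _)); rewrite normrN !normrM -mulrA mulrDl mul1r.
have A1 : `|A| <= 1 by exact: rest_cos_le1.
have B1 : `|B| <= 1 by exact: rest_sin_le1.
by apply: lerD; apply: le_trans Hc; rewrite ler_piMr.
Qed.

(** The metric is tested on the axis [j0], where [rest_cos] is 1, and only the real part is kept. *)
Lemma fourier_dist_axis (R : realType) N (I J : finType) (j0 : 'I_N)
    (la x : I -> R) (rho y : J -> R)
    (p1 : forall i, 0 <= la i) (s1 : \sum_i la i = 1)
    (p : forall i, 0 <= rho i) (s : \sum_i rho i = 1) (n : nat) (e : R)
    (nu : probability (@borel_Rn R N) R) :
  (forall f : R -> R, (forall z, f (- z) = - f z) -> \sum_i la i * f (x i) = 0) ->
  (fourier_dist n nu (prod_prob j0 x y p1 s1 p s) < e%:E)%E ->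
  forall t, t != 0 -> `|\int[nu]_v cos (t * (v : 'rV[R]_N) 0 j0) - marginal_cos la x t| <= `|t| ^+ n * e.
Proof.
move=> o H t t0; pose u : 'rV[R]_N := \row_j if j == j0 then t else 0.
have u0 : u != 0.
  by apply/eqP => /rowP/(_ j0); rewrite !mxE eqxx; exact/eqP.
have dE v : dotp u v = t * v 0 j0.
  rewrite /dotp (bigD1 j0)//= mxE eqxx big1 ?addr0// => j /negbTE jj0.
  by rewrite mxE jj0 mul0r.
have : ((ComplexField.Normc.normc (fourier nu u - fourier (prod_prob j0 x y p1 s1 p s) u)
   / norm2 u ^+ n)%:E < e%:E)%E.
  by apply: le_lt_trans H; apply: ereal_sup_ubound; exists u.
rewrite lte_fin ltr_pdivrMr ?exprn_gt0 ?norm2_gt0// norm2_axis => /ltW; rewrite mulrC.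
apply: le_trans; rewrite fourier_prod// mxE eqxx rest_cos_axis// mulr1 /fourier.
rewrite (_ : \int[nu]_v cos (t * _) = \int[nu]_v cos (dotp u v)); last first.
  by apply: eq_Rintegral => v _; rewrite dE.
exact: le_trans (le_normc_Re _ _).
Qed.

(** A multi-index of odd degree 2k+1 has an odd entry, whose factor vanishes; in degree at most 2k
    every entry is at most 2k and each factor is a prescribed moment. *)
Lemma prod_prob_prescribed (R : realType) N k (I J : finType) (j0 : 'I_N)
    (la x : I -> R) (rho y : J -> R)
    (p1 : forall i, 0 <= la i) (s1 : \sum_i la i = 1)
    (p : forall i, 0 <= rho i) (s : \sum_i rho i = 1) :
  (forall n, odd n -> \sum_i la i * x i ^+ n = 0) ->
  (forall n, odd n -> \sum_i rho i * y i ^+ n = 0) ->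
  (forall l, (l <= k)%N -> \sum_i la i * x i ^+ (2 * l) = moment k (2 * l)) ->
  (forall l, (l <= k)%N -> \sum_i rho i * y i ^+ (2 * l) = moment k (2 * l)) ->
  prescribed_moments k (2 * k + 1) (prod_prob j0 x y p1 s1 p s).
Proof.
move=> o1 o2 e1 e2.
have momE b : has_moment (prod_prob j0 x y p1 s1 p s) b (\prod_(j < N)
    (if j == j0 then \sum_i la i * x i ^+ b j else \sum_i rho i * y i ^+ b j)).
  have [? E] := integral_prod_prob j0 x y p1 s1 p s (measurable_monomial b).
  by split => //; rewrite E prod_moment.
split=> b db; have := momE b; last first.
  have [j oj] : exists j, odd (b j).
    apply: contrapT => H; have : odd (degree b) by rewrite db addn1 oddS oddM.
    apply/negP; rewrite /degree (big_morph _ oddD (erefl : odd 0 = false)).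
    rewrite big1// => j _; apply/negP => oj; apply: H; by exists j.
  by rewrite (bigD1 j)//=; case: ifP => _; rewrite ?o1 ?o2// mul0r.
congr has_moment; apply: eq_bigr => j _.
have bj : (b j <= 2 * k)%N.
  by apply: leq_trans db; rewrite /degree (bigD1 j)//= leq_addr.
have [oj|ej] := boolP (odd (b j)).
  by rewrite moment_odd// o1// o2// if_same.
have bE : b j = (2 * (b j)./2)%N.
  by rewrite -[LHS]odd_double_half (negbTE ej) add0n mul2n.
by rewrite bE e1 ?e2 ?if_same//; lia.
Qed.

(** The powers of 2^m cancel, and the minima that remain form the dyadic sum started at 1/|v|. *)
Lemma cos_rem_dyadic_le (R : realType) k n (v : R) :
  \sum_(m < n) (2 ^+ m) ^+ (2 * k.+1).+1 * cos_rem k.+1 ((2 ^+ m)^-1 * v) <=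
  4 * `|v| ^+ (2 * k.+1).+1.
Proof.
have [->|v0] := eqVneq v 0.
  by rewrite normr0 expr0n mulr0 big1// => m _; rewrite mulr0 cos_rem0 mulr0.
have v0' : 0 < `|v| by rewrite normr_gt0.
apply: (@le_trans _ _ (\sum_(m < n) `|v| ^+ (2 * k.+1).+1 *
    Num.min (`|v|^-1 * 2 ^+ m) (`|v|^-1 * 2 ^+ m)^-1)); last first.
  by rewrite -mulr_sumr mulrC ler_wpM2r ?exprn_ge0// dyadic_sum_le ?invr_gt0.
apply: ler_sum => m _; set a : R := 2 ^+ m.
have a0 : 0 < a by exact: exprn_gt0.
have -> : cos_rem k.+1 (a^-1 * v) = cos_rem k.+1 (a^-1 * `|v|).
  by case: (ger0P v) => // _; rewrite mulrN cos_remN.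
apply: (@le_trans _ _ (a ^+ (2 * k.+1).+1 * ((a^-1 * `|v|) ^+ (2 * k.+1).+1 *
    Num.min (a^-1 * `|v|) (a^-1 * `|v|)^-1))).
  by rewrite ler_pM2l ?exprn_gt0// cos_rem_le_min// mulr_gt0 ?invr_gt0.
move: (2 * k.+1).+1 => e; rewrite exprMn exprVn -mulrA mulVKf ?expf_neq0 ?gt_eqF// minC.
by rewrite !invfM !invrK (mulrC a) (mulrC a^-1).
Qed.

(** * Integrals along one coordinate for a measure in the space *)

Section axis_moments.
Context {R : realType} (N k : nat) (j0 : 'I_N) (nu : probability (@borel_Rn R N) R).
Hypothesis nuP : prescribed_moments k (2 * k + 1) nu.

Let axis n : {ffun 'I_N -> nat} := [ffun j => if j == j0 then n else 0%N].

Let monomial_axis n : monomial (axis n) = (fun v : 'rV[R]_N => v 0 j0 ^+ n).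
Proof.
apply/funext => v; rewrite /monomial (bigD1 j0)//= ffunE eqxx big1 ?mulr1// => j /negbTE jj0.
by rewrite ffunE jj0 expr0.
Qed.

Let degree_axis n : degree (axis n) = n.
Proof.
rewrite /degree (bigD1 j0)//= ffunE eqxx big1 ?addn0// => j /negbTE jj0.
by rewrite ffunE jj0.
Qed.

Lemma axis_moment n : (n <= 2 * k)%N ->
  nu.-integrable setT (EFin \o (fun v : 'rV[R]_N => v 0 j0 ^+ n)) /\
  \int[nu]_v ((v : 'rV[R]_N) 0 j0 ^+ n) = moment k n.
Proof.
move=> nk; have [] := nuP.1 (axis n); first by rewrite degree_axis.
rewrite monomial_axis => ? ->; split=> //.
rewrite (bigD1 j0)//= ffunE eqxx big1 ?mulr1// => j /negbTE jj0.
by rewrite ffunE jj0 moment0.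
Qed.

Lemma axis_integrable :
  nu.-integrable setT (EFin \o (fun v : 'rV[R]_N => v 0 j0 ^+ (2 * k + 1))).
Proof. by rewrite -monomial_axis; have [] := nuP.2 (axis (2 * k + 1)) (degree_axis _). Qed.

Let coord_measurable := @measurable_coord R N j0.

Lemma integrable_cos_axis t :
  nu.-integrable setT (EFin \o (fun v : 'rV[R]_N => cos (t * v 0 j0))).
Proof.
apply: measurable_bounded_integrable => //.
- by apply: (le_lt_trans (probability_le1 nu measurableT)); rewrite ltry.
- apply: (measurableT_comp (f := @cos R)); last exact: measurable_funM.
  by apply: continuous_measurable_fun; exact: continuous_cos.
- exists 1; split => // M M1 v _.
  by apply: (le_trans _ (ltW M1)) => /=; rewrite ler_norml cos_geN1 cos_le1.
Qed.

(** The polynomial part involves prescribed moments only, hence is common to all measures in the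
    space and cancels in comparisons. *)
Lemma integral_cos_rem_axis (c : nat -> R) :
  (forall u, cos_rem k u = (-1) ^+ k.+1 * cos u + \sum_(l < k.+1) c l * u ^+ (2 * l)) ->
  forall t,
  nu.-integrable setT (EFin \o (fun v : 'rV[R]_N => cos_rem k (t * v 0 j0))) /\
  \int[nu]_v cos_rem k (t * (v : 'rV[R]_N) 0 j0) =
    (-1) ^+ k.+1 * (\int[nu]_v cos (t * (v : 'rV[R]_N) 0 j0)) +
    \sum_(l < k.+1) c l * t ^+ (2 * l) * moment k (2 * l).
Proof.
move=> cE t.
pose f (v : @borel_Rn R N) : R := (-1) ^+ k.+1 * cos (t * (v : 'rV[R]_N) 0 j0).
pose g (l : 'I_k.+1) (v : @borel_Rn R N) : R :=
  c l * t ^+ (2 * l) * (v : 'rV[R]_N) 0 j0 ^+ (2 * l).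
have fE (v : @borel_Rn R N) : cos_rem k (t * (v : 'rV[R]_N) 0 j0) = f v + \sum_l g l v.
  rewrite cE /f /g; congr (_ + _); apply: eq_bigr => l _.
  by rewrite exprMn mulrA.
have lk (l : 'I_k.+1) : (2 * l <= 2 * k)%N by rewrite leq_mul2l -ltnS ltn_ord.
have If : nu.-integrable setT (EFin \o f).
  have /(integrableZl measurableT ((-1) ^+ k.+1)) := integrable_cos_axis t.
  by apply: (eq_integrable measurableT).
have Ig l : nu.-integrable setT (EFin \o g l).
  have /(integrableZl measurableT (c l * t ^+ (2 * l))) := (axis_moment (lk l)).1.
  by apply: (eq_integrable measurableT).
have Is : nu.-integrable setT (EFin \o (fun v => \sum_l g l v)) by exact: integrable_Rsum.
split.
  have := integrableD measurableT If Is.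
  by apply: (eq_integrable measurableT) => v _ /=; rewrite fE.
under eq_Rintegral do rewrite fE.
rewrite RintegralD// Rintegral_sum// RintegralZl//; last exact: integrable_cos_axis.
congr (_ + _); apply: eq_bigr => l _; rewrite RintegralZl//; last exact: (axis_moment (lk l)).1.
by rewrite (axis_moment (lk l)).2.
Qed.

End axis_moments.

Lemma far_mass_dyadic (R : realType) k i :
  (2 ^+ i) ^+ (2 * k.+1).+1 * @far_mass R k i = i.+1%:R^-1.
Proof. by rewrite /far_mass mulrA mulfV ?mul1r// !expf_neq0. Qed.

Lemma harmonic_unbounded (R : realType) (a b : R) : 0 < a ->
  exists n, b < a * \sum_(i < n) i.+1%:R^-1.
Proof.
move=> a0; apply: contrapT => H; apply: (@dvg_harmonic R).
have H' n : \sum_(i < n) i.+1%:R^-1 <= b / a.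
  rewrite ler_pdivlMr// mulrC leNgt; apply/negP => nb; by apply: H; exists n.
apply: nondecreasing_is_cvgn.
  apply: nondecreasing_series => n _ _; exact: harmonic_ge0.
exists (b / a) => _ [n _ <-]; rewrite seriesEord; exact: H'.
Qed.

Lemma heavy_prob_finite_set (R : realType) k (A : set R) :
  finite_set A -> measurable A -> @heavy_prob R k A = 0%E.
Proof.
move=> fA mA; apply: heavy_prob0 => //.
by apply: countable_lebesgue_measure0; exact: finite_set_countable.
Qed.

(** * A Cauchy sequence without limit *)

Theorem theorem4p6 (R : realType) (k s N : nat)
  (hk : (1 <= k)%N) (hs : s = (2 * k + 1)%N) (hN : (1 <= N)%N) :
  ~ complete_space (P_eq R N k s).
Proof.
(* From here on [k] is one less than in the statement, so the critical order is 2k+3. *)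
case: k hk hs => // k _ ->.
have [pts [rho [K [B [B0 rho0 K_le rhoM K_dual]]]]] :=
  @atomic_even_moments R (@heavy_prob R k.+1) k.+1
    (integrable_heavy_prob _ (leqnn _)) (@heavy_prob_finite_set R k.+1).
pose L := functional pts rho K B.
pose mass p : atom_index pts p -> R := @index_mass R k pts rho K B p.
pose atom p : atom_index pts p -> R := @index_atom R pts p.
have Lpow p l : (l <= k.+1)%N -> L p (fun y => y ^+ (2 * l)) = moment k.+1 (2 * l).
  rewrite -ltnS => lk.
  exact: (functional_pow (M := fun l => moment k.+1 (2 * l)) B rhoM K_dual p (Ordinal lk)).
have mass_ge0 p i : 0 <= mass p i by exact: index_mass_ge0.
have mass_odd p f : (forall y, f (- y) = - f y) -> \sum_i mass p i * f (atom p i) = 0.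
  exact: sum_index_odd.
have mass_even p f : (forall y, f (- y) = f y) -> \sum_i mass p i * f (atom p i) = L p f.
  exact: sum_index_even.
have mass_pow p l : (l <= k.+1)%N ->
    \sum_i mass p i * atom p i ^+ (2 * l) = moment k.+1 (2 * l).
  move=> lk; rewrite (mass_even p (fun y => y ^+ (2 * l))) ?Lpow// => y.
  by rewrite !exprM sqrrN.
have mass1 p : \sum_i mass p i = 1.
  rewrite -[RHS](moment0 R k.+1) -(mass_pow p 0%N isT).
  by apply: eq_bigr => i _; rewrite mulr1.
have mass_oddX p n : odd n -> \sum_i mass p i * atom p i ^+ n = 0.
  move=> on; apply: (mass_odd p (fun y => y ^+ n)) => y.
  by rewrite exprNn -signr_odd on expr1 mulN1r.
pose j0 := Ordinal hN.
(* Coordinate [j0] carries the perturbed measure of index [p]; all others carry the one of index 0,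
   which has no far masses. *)
pose nu p := prod_prob j0 (atom p) (atom 0%N) (mass_ge0 p) (mass1 p) (mass_ge0 0%N) (mass1 0%N).
have nuP p : prescribed_moments k.+1 (2 * k.+1 + 1) (nu p).
  by apply: prod_prob_prescribed; [exact: mass_oddX|exact: mass_oddX|exact: mass_pow|exact: mass_pow].
pose P p : P_eq R N k.+1 (2 * k.+1 + 1) := exist _ (nu p) (nuP p).
have [c cE] := cos_rem_closed R k.+1.
pose poly_part t := \sum_(l < k.+2) c l * t ^+ (2 * l) * moment k.+1 (2 * l).
have L_cos_rem p t : L p (fun y => cos_rem k.+1 (t * y)) =
    (-1) ^+ k.+2 * marginal_cos (mass p) (atom p) t + poly_part t.
  rewrite /marginal_cos (mass_even p (fun y => cos (t * y))); last first.
    by move=> y; rewrite mulrN cosN.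
  pose f (l : nat) y := c l * t ^+ (2 * l) * y ^+ (2 * l).
  rewrite (_ : poly_part t = L p (fun y => \sum_(l < k.+2) f l y)); last first.
    rewrite /L functional_sum; apply: eq_bigr => l _.
    by rewrite /f functionalZ [functional _ _ _ _ _ _]Lpow// -ltnS.
  rewrite /L -functionalZ -functionalD; apply: eq_functional => y.
  by rewrite cE; congr (_ + _); apply: eq_bigr => l _; rewrite exprMn /f mulrA.
pose D := scale k B * (4 + 2 * near_bound pts K).
have cos_diff q p t : (q <= p)%N -> `|marginal_cos (mass q) (atom q) t -
    marginal_cos (mass p) (atom p) t| <= `|t| ^+ (2 * k.+1 + 1) * (D / q.+1%:R).
  move=> qp; have := functional_cos_rem_diff pts rho K B0 t qp.
  rewrite -/L !L_cos_rem opprD addrACA subrr addr0 -mulrBr normrM normrX normrN1 expr1n mul1r distrC.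
  by rewrite addn1.
have dist_le q p : (q <= p)%N -> (fourier_dist (2 * k.+1 + 1) (nu q) (nu p) <= (2 * (D / q.+1%:R))%:E)%E.
  move=> qp; apply: fourier_dist_prod_le; [exact: mass_odd|exact: mass_odd|].
  by move=> t; exact: cos_diff.
move=> /(_ (P @ \oo)) [].
- apply: cauchy_exP => e e0.
  have [q qe] : exists q : nat, 2 * D / e < q.+1%:R.
    by exists (Num.truncn (2 * D / e)); exact: truncnS_gt.
  exists (P q), q => // p /= qp.
  apply: (le_lt_trans (dist_le q p qp)); rewrite lte_fin mulrA.
  by rewrite ltr_pdivrMr// [e * _]mulrC -ltr_pdivrMr.
move=> l Pl; have lP := proj2_sig l; set la := sval l in lP.
(* The index [p] is taken at least [n] so that the first [n] far masses are all present. *)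
have near_cos n e : 0 < e -> exists p, (n <= p)%N /\ forall t, t != 0 ->
    `|\int[la]_v cos (t * (v : 'rV[R]_N) 0 j0) - marginal_cos (mass p) (atom p) t| <=
    `|t| ^+ (2 * k.+1 + 1) * e.
  move=> e0; have /cvg_ballP/(_ e e0) [p0 _ Hp0] := Pl.
  exists (maxn n p0); split; first exact: leq_maxl.
  have H : (fourier_dist (2 * k.+1 + 1) la (nu (maxn n p0)) < e%:E)%E.
    exact: (Hp0 (maxn n p0) (leq_maxr _ _)).
  exact: (fourier_dist_axis (@mass_odd (maxn n p0)) H).
pose r := scale k B * cos_rem k.+1 1.
have r0 : 0 < r by rewrite mulr_gt0 ?scale_gt0 ?cos_rem1_gt0.
pose sd := (2 * k.+1).+1.
(* Membership in the space includes integrability at the critical order; the rest of the proof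
   refutes this. *)
have int_norm : la.-integrable setT (EFin \o (fun v : 'rV[R]_N => `|v 0 j0| ^+ sd)).
  have := integrable_norm (axis_integrable j0 lP); rewrite addn1.
  by apply: (eq_integrable measurableT) => v _ /=; rewrite normrX.
pose E := \int[la]_v (`|(v : 'rV[R]_N) 0 j0| ^+ sd).
(* The summand 1 absorbs the approximation errors: [n] scales, each contributing 1/(n+1). *)
have [n Hn] := harmonic_unbounded (4 * E + 1) r0.
have [p [np Hp]] := near_cos n n.+1%:R^-1 ltac:(by rewrite invr_gt0).
(* At this frequency the atom 2^m is seen at argument 1, where the remainder is positive. *)
pose t m : R := (2 ^+ m)^-1.
have t0 m : 0 < t m by rewrite invr_gt0 exprn_gt0.
pose S m := \int[la]_v cos_rem k.+1 (t m * (v : 'rV[R]_N) 0 j0).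
have S_ge m : (m < n)%N -> r * m.+1%:R^-1 - n.+1%:R^-1 <= (2 ^+ m) ^+ sd * S m.
  move=> mn; have SL : `|S m - L p (fun y => cos_rem k.+1 (t m * y))| <= t m ^+ sd * n.+1%:R^-1.
    (* Both sides have the same polynomial part, so only the cosine transforms are compared. *)
    rewrite /S (integral_cos_rem_axis j0 lP cE (t m)).2 L_cos_rem opprD addrACA subrr addr0 -mulrBr.
    rewrite normrM normrX normrN1 expr1n mul1r.
    have /(_ (lt0r_neq0 (t0 m))) := Hp (t m).
    by rewrite (gtr0_norm (t0 m)) addn1.
  have := functional_ge_far pts B0 rho0 K_le (f := fun y => cos_rem k.+1 (t m * y))
    (fun y => cos_rem_ge0 _ _) (leq_trans mn np).
  rewrite -/L mulVf ?expf_neq0// => Lge.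
  have tE : (2 ^+ m) ^+ sd * t m ^+ sd = 1.
    by rewrite -exprMn mulfV ?expr1n// expf_neq0.
  have -> : r * m.+1%:R^-1 - n.+1%:R^-1 = (2 ^+ m) ^+ sd *
      (scale k B * (far_mass k m * cos_rem k.+1 1) - t m ^+ sd * n.+1%:R^-1).
    rewrite mulrBr (mulrA _ (t m ^+ sd)) tE mul1r; congr (_ - _).
    by rewrite -(far_mass_dyadic R k m) /r /sd; ring.
  rewrite ler_pM2l; last by rewrite !exprn_gt0.
  move: SL; rewrite ler_norml lerBrDl => /andP[+ _]; apply: le_trans.
  by rewrite lerD2r.
have S_le : \sum_(m < n) (2 ^+ m) ^+ sd * S m <= 4 * E.
  have Ic m : la.-integrable setT
      (EFin \o (fun v : 'rV[R]_N => (2 ^+ m) ^+ sd * cos_rem k.+1 (t m * v 0 j0))).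
    have /(integrableZl measurableT ((2 ^+ m) ^+ sd)) := (integral_cos_rem_axis j0 lP cE (t m)).1.
    by apply: (eq_integrable measurableT).
  under eq_bigr do rewrite -RintegralZl ?(integral_cos_rem_axis j0 lP cE _).1//.
  rewrite -(Rintegral_sum (index_enum _) (fun m : 'I_n => Ic m)) -RintegralZl//.
  apply: le_Rintegral => //.
  - exact: (integrable_Rsum _ (fun m : 'I_n => Ic m)).
  - have /(integrableZl measurableT 4) := int_norm.
    by apply: (eq_integrable measurableT).
  - by move=> v _; exact: cos_rem_dyadic_le.
have : r * \sum_(m < n) m.+1%:R^-1 - 1 <= \sum_(m < n) (2 ^+ m) ^+ sd * S m.
  apply: (@le_trans _ _ (\sum_(m < n) (r * m.+1%:R^-1 - n.+1%:R^-1))); last first.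
    by apply: ler_sum => m _; exact: S_ge.
  rewrite sumrB -mulr_sumr lerD2l lerN2 sumr_const card_ord -[_ *+ n]mulr_natr mulrC.
  by rewrite ler_pdivrMr// mul1r ler_nat.
by move=> H; move: Hn; rewrite ltNge; apply/negP/negPn; lra.
Qed.
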